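(* Consider the abstract elementary class ${}^\perp(\mathbb{Z}^\omega/\mathbb{Z}^{(\omega)})$ with its strong submodel relation $<$ given by: $G<H$ iff $G$ is a subgroup of $H$ and both $G$ and $H/G$ belong to ${}^\perp(\mathbb{Z}^\omega/\mathbb{Z}^{(\omega)})$. (1) If CH holds, then ${}^\perp(\mathbb{Z}^\omega/\mathbb{Z}^{(\omega)})$ is stable in $\aleph_1$ (in fact in all $\aleph_n$, $0<n<\omega$), but not stable in $\aleph_\omega$. (2) If CH fails, then ${}^\perp(\mathbb{Z}^\omega/\mathbb{Z}^{(\omega)})$ is not stable in $\aleph_1$.
   Context: All groups are abelian. For a group $X$, ${}^\perp X$ is the class of all abelian groups $G$ with $\mathrm{Ext}(G,X)=0$. $\mathbb{Z}^\omega$ is the direct product and $\mathbb{Z}^{(\omega)}$ the direct sum of countably many copies of $\mathbb{Z}$. CH is the continuum hypothesis $2^{\aleph_0}=\aleph_1$. Stability is meant in the sense of Galois types in an abstract elementary class. For $M$ in the class, consider triples $(M,a,N)$ with $M<N$ and $a\in N$. Two triples $(M,a,N)$ and $(M,b,N')$ are directly related if there are $N''$ in the class and embeddings $f:N\to N''$, $g:N'\to N''$, whose images are strong submodels of $N''$, which are the identity on $M$ and satisfy $f(a)=g(b)$. Galois types over $M$ are the classes of the equivalence relation generated by this relation. The class is stable in an infinite cardinal $\lambda$ if for every member $M$ of the class of cardinality $\lambda$ there are at most $\lambda$ Galois types over $M$. *)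

(* Defs.v *)
From Stdlib Require Import Relations.
From HB Require Import structures.
From mathcomp Require Import all_boot all_order all_algebra.
From mathcomp Require Import boolp classical_sets functions cardinality.

Set Implicit Arguments.
Unset Strict Implicit.
Unset Printing Implicit Defensive.

Import GRing.Theory.
Local Open Scope classical_set_scope.
Local Open Scope card_scope.
Local Open Scope ring_scope.

Section SubgroupType.
Context (H : zmodType) (G : zmodClosed H).

Record subgroup : Type := Subgroup { subgroup_val : H; _ : subgroup_val \in G }.

HB.instance Definition _ := [isSub for subgroup_val].
HB.instance Definition _ := [Choice of subgroup by <:].
HB.instance Definition _ := [SubChoice_isSubZmodule of subgroup by <:].

End SubgroupType.

Section Image.
Context (U V : zmodType) (f : {additive U -> V}).

Definition im : V -> bool := [in range f].

Fact im_zmod_closed : zmod_closed im.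
Proof.
split=> [|x y]; rewrite /in_mem /= /im.
  by apply/mem_set; exists 0; rewrite ?raddf0.
move=> /set_mem[a _ <-] /set_mem[b _ <-].
by apply/mem_set; exists (a - b); rewrite ?raddfB.
Qed.

HB.instance Definition _ := GRing.isZmodClosed.Build V im im_zmod_closed.

End Image.

(** [finsupp_seq] is the direct sum inside the direct product [nat -> int]. *)
Definition finsupp_seq : (nat -> int) -> bool :=
  fun u => `[< finite_set [set n | u n != 0] >].

Fact finsupp_seq_zmod_closed : zmod_closed finsupp_seq.
Proof.
split=> [|u v]; rewrite /in_mem /= /finsupp_seq.
  apply/asboolP; rewrite [X in finite_set X](_ : _ = set0) ?seteqP //.
  by split=> // n /=; rewrite eqxx.
move=> /asboolP fu /asboolP fv; apply/asboolP.
apply: (@sub_finite_set _ _ ([set n | u n != 0] `|` [set n | v n != 0])); last first.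
  by rewrite finite_setU.
move=> n /= uvn0; have [u0|un0] := eqVneq (u n) 0; last by left.
right; apply: contra_neq uvn0 => v0.
by rewrite -[LHS]/(u n - v n) u0 v0 subrr.
Qed.

HB.instance Definition _ :=
  GRing.isZmodClosed.Build (nat -> int) finsupp_seq finsupp_seq_zmod_closed.

Definition ZomegaModSum : zmodType :=
  Quotient.quot (GRing.ZmodClosed.clone (nat -> int) finsupp_seq _).

Record extension (G X : zmodType) := Extension {
  ext_mid : zmodType;
  ext_in : {additive X -> ext_mid};
  ext_out : {additive ext_mid -> G};
  ext_in_inj : injective ext_in;
  ext_out_surj : forall g, exists b, ext_out b = g;
  ext_exact : forall b, ext_out b = 0 <-> exists x, ext_in x = b
}.

Definition ext_equiv (G X : zmodType) (E E' : extension G X) : Prop :=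
  exists phi : {additive ext_mid E -> ext_mid E'},
    [/\ bijective phi,
        forall x, phi (ext_in E x) = ext_in E' x
      & forall b, ext_out E' (phi b) = ext_out E b].

Section SplitExtension.
Context (G X : zmodType).

Definition split_in (x : X) : (X * G)%type := (x, 0).
Definition split_out (b : (X * G)%type) : G := b.2.

Fact split_in_zmod_morphism : zmod_morphism split_in.
Proof. by move=> x y; congr pair; rewrite subr0. Qed.

Fact split_out_zmod_morphism : zmod_morphism split_out.
Proof. by []. Qed.

HB.instance Definition _ :=
  GRing.isZmodMorphism.Build X (X * G)%type split_in split_in_zmod_morphism.
HB.instance Definition _ :=
  GRing.isZmodMorphism.Build (X * G)%type G split_out split_out_zmod_morphism.

Fact split_in_inj : injective split_in.
Proof. by move=> x y []. Qed.

Fact split_out_surj g : exists b, split_out b = g.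
Proof. by exists (0, g). Qed.

Fact split_exact b : split_out b = 0 <-> exists x, split_in x = b.
Proof.
by case: b => x g; split=> [/= ->|[y [_ <-]]] //; exists x.
Qed.

Definition split_ext : extension G X :=
  Extension split_in_inj split_out_surj split_exact.

End SplitExtension.

(** Ext(G, X) is the group of equivalence classes of extensions of G by X
    under Baer sum, whose zero is the class of the split extension. *)
Definition Ext_zero (G X : zmodType) : Prop :=
  forall E : extension G X, ext_equiv E (split_ext G X).

Definition perp (X G : zmodType) : Prop := Ext_zero G X.

Definition strong_submodel (X H : zmodType) (G : zmodClosed H) : Prop :=
  perp X (subgroup G) /\ perp X (Quotient.quot G).

Definition strong_embedding (X G H : zmodType) (f : {additive G -> H}) : Prop :=
  injective f /\ strong_submodel X (GRing.ZmodClosed.clone H (im f) _).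

(** A triple (M, a, N) with M < N: the inclusion of M in N is rendered by an
    injective morphism onto a strong submodel, so that different N can be
    extensions of the same M. *)
Record triple (X M : zmodType) := Triple {
  tr_model : zmodType;
  tr_incl : {additive M -> tr_model};
  tr_strong : strong_embedding X tr_incl;
  tr_elt : tr_model
}.

Definition directly_related (X M : zmodType) (t t' : triple X M) : Prop :=
  exists (N : zmodType) (f : {additive tr_model t -> N})
         (g : {additive tr_model t' -> N}),
    [/\ perp X N, strong_embedding X f, strong_embedding X g,
        forall m, f (tr_incl t m) = g (tr_incl t' m)
      & f (tr_elt t) = g (tr_elt t')].

Definition same_galois_type (X M : zmodType) : triple X M -> triple X M -> Prop :=
  clos_refl_sym_trans (triple X M) (@directly_related X M).

(** The triples over M live in a universe above that of [set] in
    [classical_sets], so [#<=] does not apply to the collection of their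
    classes; a map c on triples that identifies exactly the equivalent ones is
    the same as an injection of the set of Galois types over M into L. *)
Definition at_most_galois_types (X M : zmodType) (L : Type) : Prop :=
  exists c : triple X M -> L,
    forall t t', c t = c t' <-> same_galois_type t t'.

(** Cardinals are represented by types having that cardinality. *)
Definition stable_in (X : zmodType) (L : Type) : Prop :=
  forall M : zmodType, perp X M -> [set: M] #= [set: L] ->
    at_most_galois_types X M L.

Definition successor_cardinal (K L : Type) : Prop :=
  ~~ ([set: L] #<= [set: K]) /\
  forall J : Type, ~~ ([set: J] #<= [set: K]) -> [set: L] #<= [set: J].

Fixpoint is_aleph (n : nat) (L : Type) : Prop :=
  if n is m.+1 then exists K : Type, is_aleph m K /\ successor_cardinal K L
  else [set: L] #= [set: nat].

Definition is_aleph_omega (L : Type) : Prop :=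
  (forall n K, is_aleph n K -> [set: K] #<= [set: L]) /\
  (forall J : Type, (forall n K, is_aleph n K -> [set: K] #<= [set: J]) ->
     [set: L] #<= [set: J]).

Definition CH : Prop := is_aleph 1 (nat -> bool).

(* Main.v *)
(** Write A for Z^omega / Z^(omega). The class of all G with Ext(G, A) = 0 is the
    class of torsion-free groups. If G is torsion-free, an extension of G by A is
    split by extending a complement of A through pure subgroups, one rank-one
    step at a time; such a step amounts to solving x_n = k_n x_(n+1) + a_n in A,
    which can be done coordinatewise. If g in G has order k > 1, divisibility of
    Q^omega / Q^(omega) yields an extension in which k times a lift of g is the
    class of the constant sequence 1, which is not divisible by k in A.

    So the strong submodels are the pure subgroups, and the type of (M, a, N) is
    determined by the triples (n, z, m) such that n divides z a + m in N: the
    amalgam is the sum of the two models modulo the elements they must share.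
    For given n and z the possible m form a coset of nM, hence there are at most
    |M|^omega types. Conversely the 2-adic sums of the 2^k e_(k, eta(k)), for eta
    in L^omega, have different types over the free group on omega x L, so that
    stability in an infinite L means |L|^omega <= |L|. Under CH this holds for
    aleph_n with n > 0, by Hausdorff's formula; by König it fails for aleph_omega,
    and for aleph_1 it implies CH. *)

From HB Require Import structures.
From Stdlib Require Import Relations.
Require Import Defs.
From mathcomp Require Import all_boot all_order all_algebra.
From mathcomp Require Import generic_quotient boolp classical_sets functions.
From mathcomp Require Import cardinality ring zify.

Set Implicit Arguments.
Unset Strict Implicit.
Unset Printing Implicit Defensive.

Import GRing.Theory.
Local Open Scope classical_set_scope.

(** * Cardinals *)

(** [Zorn_bigcup] is applied to the sets whose union with [A0] satisfies [P]. The empty chain then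
    gives [A0] itself, so that only nonempty chains remain. *)
Lemma Zorn_above (T : Type) (P : set (set T)) (A0 : set T) : P A0 ->
    (forall F : set (set T), F !=set0 -> F `<=` P -> total_on F subset ->
      P (\bigcup_(X in F) X)) ->
  exists A, [/\ A0 `<=` A, P A & forall B, A `<=` B -> P B -> B `<=` A].
Proof.
move=> PA0 PF; have [|A [PA Amax]] := @Zorn_bigcup _ [set A | P (A `|` A0)].
  move=> F FP Ftot /=; have [->|/set0P F0] := eqVneq F set0.
    by rewrite bigcup_set0 set0U.
  rewrite -bigcupUl //.
  have -> : \bigcup_(i in F) (i `|` A0) = \bigcup_(X in (setU^~ A0) @` F) X.
    by rewrite bigcup_image.
  apply: PF.
  - by case: F0 => X FX; exists (X `|` A0); exists X.
  - by move=> _ [X FX <-]; apply: FP.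
  - move=> _ _ [X FX <-] [Y FY <-].
    by have [XY|YX] := Ftot _ _ FX FY; [left|right]; apply: setSU.
exists (A `|` A0); split=> // B AB PB.
have PB' : P (B `|` A0) by rewrite (setUidl (subset_trans (@subsetUr _ A A0) AB)).
have AB' : A `<=` B := subset_trans (@subsetUl _ A A0) AB.
have [BA|nBA] := pselect (B `<=` A); first exact: subset_trans (@subsetUl _ _ _).
by case: (Amax B) => //; split.
Qed.

Definition embeds (A B : Type) : Prop := exists f : A -> B, injective f.

Lemma card_le_embeds (A B : Type) :
  ([set: A] #<= [set: B])%card <-> embeds A B.
Proof.
split=> [/card_leP[f]|[f finj]].
  pose g (a : A) : [set: A] := SigSub (mem_setT a).
  exists (fun a => \val (f (g a))) => a b /val_inj.
  by move=> /(@inj _ _ _ f); rewrite !inE => /(_ I I)[].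
have [g] : $|{injfun [set: A] >-> [set: B]}|.
  by apply/injfunPex; exists f => // a b _ _ /finj.
exact: inj_card_le g.
Qed.

Lemma card_eq_embeds (A B : Type) :
  ([set: A] #= [set: B])%card -> embeds A B /\ embeds B A.
Proof. by rewrite card_eq_le => /andP[/card_le_embeds ? /card_le_embeds]. Qed.

Lemma embeds_refl A : embeds A A.
Proof. by exists id. Qed.

Lemma embeds_trans B A C : embeds A B -> embeds B C -> embeds A C.
Proof. by move=> [f finj] [g ginj]; exists (g \o f); apply: inj_comp. Qed.

Lemma embeds_prod A A' B B' :
  embeds A A' -> embeds B B' -> embeds (A * B) (A' * B').
Proof.
move=> [f finj] [g ginj]; exists (fun p => (f p.1, g p.2)).
by move=> [a b] [c d] /= [/finj-> /ginj->].
Qed.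

Lemma embeds_fun I J A B : embeds J I -> embeds A B -> inhabited A ->
  embeds (J -> A) (I -> B).
Proof.
move=> [h hinj] [g ginj] [a0].
exists (fun u i => g (if pselect (exists j, h j = i) is left e
                      then u (projT1 (cid e)) else a0)) => u v uv.
apply/funext => j; have := congr1 (fun w => w (h j)) uv => /ginj.
case: pselect => [e|[]]; last by exists j.
by case: (cid e) => j' /= /hinj ->.
Qed.

Lemma sval_inj (T : Type) (P : T -> Prop) : injective (@proj1_sig T P).
Proof. by move=> [x Px] [y Py] /= xy; apply: eq_exist. Qed.

Lemma embeds_sig (T : Type) (S : set T) : embeds {x | S x} T.
Proof. by exists (@proj1_sig _ _); apply: sval_inj. Qed.

Lemma embeds_range (A T : Type) (f : A -> T) (S : set T) :
  injective f -> (forall a, S (f a)) -> embeds A {x | S x}.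
Proof. by move=> finj Sf; exists (fun a => exist _ (f a) (Sf a)) => a b [/finj]. Qed.

Lemma Cantor K : ~ embeds (set K) K.
Proof.
move=> [f finj]; pose D := [set x | exists2 S, f S = x & ~ S x].
have [Df|nDf] := pselect (D (f D)); last by apply: (nDf); exists D.
by have [S /finj SD] := Df; rewrite SD.
Qed.

(** A maximal set of pairwise disjoint sections of [X] exhausts some [X i],
    which then injects in all the others. *)
Lemma embeds_min (I : Type) (X : I -> Type) : inhabited I ->
  exists i, forall j, embeds (X i) (X j).
Proof.
move=> [i0]; pose P (S : set (forall i, X i)) :=
  forall i f g, S f -> S g -> f i = g i -> f = g.
have [||S [_ PS Smax]] := @Zorn_above _ P set0; first by [].
  move=> F _ FP Ftot i f g [A FA Af] [B FB Bg].
  by have [AB|BA] := Ftot _ _ FA FB;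
    [apply: (FP _ FB) => //; apply: AB|apply: (FP _ FA) => //; apply: BA].
have [[i iS]|nS] := pselect (exists i, forall x, exists f, S f /\ f i = x).
  exists i => j; have [r rP] := choice iS; exists (fun x => r x j) => x y rxy.
  have [Sx <-] := rP x; have [Sy <-] := rP y.
  by rewrite (PS j _ _ Sx Sy rxy).
have h i : exists x, forall f, S f -> f i <> x.
  apply: contrapT => nx; apply: nS; exists i => x; apply: contrapT => nf.
  by apply: nx; exists x => f Sf fx; apply: nf; exists f.
(* If no [X i] is exhausted, the missed values form a section disjoint from all of [S], against
   maximality. *)
pose s i := projT1 (cid (h i)).
have sP i f : S f -> f i <> s i by apply: projT2 (cid (h i)) f.
have Ss : S s.
  apply: (Smax (S `|` [set s])); [exact: subsetUl| |by right].
  move=> i f g [Sf|->] [Sg|->] // e.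
  - exact: PS Sf Sg e.
  - by case: (sP i f Sf).
  - by case: (sP i g Sg).
by case: (sP i0 s Ss).
Qed.

Lemma embeds_total A B : embeds A B \/ embeds B A.
Proof.
have [[] h] := @embeds_min bool (fun b => if b then A else B) (inhabits true).
  by left; apply: (h false).
by right; apply: (h true).
Qed.

(** * Successor cardinals and alephs *)

Lemma notin_embeds K L : ~~ ([set: L] #<= [set: K])%card <-> ~ embeds L K.
Proof. by rewrite -card_le_embeds; split=> /negP. Qed.

Lemma successor_embeds K L : successor_cardinal K L <->
  ~ embeds L K /\ forall J, ~ embeds J K -> embeds L J.
Proof.
split=> -[/notin_embeds LK h]; split=> // J.
  by move=> /notin_embeds /h /card_le_embeds.
by move=> /notin_embeds /h /card_le_embeds.
Qed.

(** The witness has least cardinality among the sets of subsets of [K] that do not embed in [K]. A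
    competitor [J] that embeds in it is replaced by its image, which belongs to the same family. *)
Lemma successor_exists K : exists L, successor_cardinal K L.
Proof.
have nT : ~ embeds {x : set K | setT x} K.
  move=> h; apply: (@Cantor K); apply: embeds_trans h.
  exact: (@embeds_range _ _ id).
pose I := {S : set (set K) | ~ embeds {x | S x} K}.
pose X (S : I) := {x | sval S x}.
have [[S /= nS] Smin] := @embeds_min I X (inhabits (exist _ setT nT)).
exists (X (exist _ S nS)); apply/successor_embeds; split=> // J nJ.
have [|[j jinj]] := embeds_total (X (exist _ S nS)) J; first by [].
pose R := range (fun x => sval (j x)).
have jR : injective (fun x => sval (j x)).
  by move=> x y /sval_inj/jinj.
have nR : ~ embeds {x | R x} K.
  move=> h; apply: nJ; apply: embeds_trans h.
  by apply: (embeds_range jR) => x; exists x.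
apply: embeds_trans (Smin (exist _ R nR)) _.
have /choice[r rP] (x : {x | R x}) : exists y : J, sval (j y) = sval x.
  by case: x => x [y _ yx] /=; exists y.
by exists r => x y rxy; apply: sval_inj; rewrite -!rP rxy.
Qed.

Lemma is_aleph_exists n : exists K, is_aleph n K.
Proof.
elim: n => [|n [K Kn]]; first by exists nat; apply: card_eqxx.
by have [L KL] := successor_exists K; exists L, K.
Qed.

Lemma is_aleph_infinite n K : is_aleph n K -> embeds nat K.
Proof.
elim: n K => [K /card_eq_embeds[]//|n IH L [K [/IH natK]]].
move=> /successor_embeds[nLK _].
by have [/nLK//|] := embeds_total L K; apply: embeds_trans.
Qed.

(** * Idempotence of infinite cardinals *)

Section Square.
Variables (A : Type).
Hypotheses (infA : embeds nat A) (sqA : embeds (A * A) A).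

Lemma embeds_prod_self B C : embeds B A -> embeds C A -> embeds (B * C) A.
Proof. by move=> BA CA; apply: embeds_trans (embeds_prod BA CA) sqA. Qed.

Lemma embeds_count (B : countType) : embeds B A.
Proof. by apply: embeds_trans infA; exists pickle; apply: pcan_inj pickleK. Qed.

(** Lists are folded into [A] by iterated pairing; the length kept beside the result makes this
    injective. *)
Lemma embeds_seq : embeds (seq A) A.
Proof.
have [p pinj] := sqA; have [e einj] := infA.
apply: (@embeds_trans (nat * A)); last first.
  exact: embeds_prod_self infA (embeds_refl A).
pose c := foldr (fun x y => p (x, y)) (e 0).
exists (fun s => (size s, c s)) => s t [].
by elim: s t => [|x s IH] [|y t] //= [st] /pinj [-> /(IH _ st)->].
Qed.

End Square.

(** The graph of an injection of D x D into D for some subset D of [L]. D is read off the diagonal,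
    so that Zorn's lemma ranges over a single set. *)
Definition square_graph (L : Type) (G : set (L * L * L)) : Prop :=
  let D x := exists z, G (x, x, z) in
  [/\ forall p z z', G (p, z) -> G (p, z') -> z = z',
      forall p p' z, G (p, z) -> G (p', z) -> p = p',
      forall x y z, G (x, y, z) -> [/\ D x, D y & D z]
    & forall x y, D x -> D y -> exists z, G (x, y, z)].

Lemma square_graph_bigcup L (F : set (set (L * L * L))) :
  F `<=` @square_graph L -> total_on F subset ->
  square_graph (\bigcup_(X in F) X).
Proof.
move=> FP Ftot; have F2 G G' : F G -> F G' ->
    exists2 H, F H & G `<=` H /\ G' `<=` H.
  by move=> FG FG'; have [h|h] := Ftot _ _ FG FG'; [exists G'|exists G] => //; split.
split.
- move=> p z z' [G FG Gz] [G' FG' Gz']; have [H FH [GH GH']] := F2 _ _ FG FG'.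
  by have [h _ _ _] := FP _ FH; apply: h (GH _ Gz) (GH' _ Gz').
- move=> p p' z [G FG Gz] [G' FG' Gz']; have [H FH [GH GH']] := F2 _ _ FG FG'.
  by have [_ h _ _] := FP _ FH; apply: h (GH _ Gz) (GH' _ Gz').
- move=> x y z [G FG Gz]; have [_ _ /(_ _ _ _ Gz)[[a ha] [b hb] [c hc]] _] := FP _ FG.
  by split; [exists a|exists b|exists c]; exists G.
- move=> x y [a [G FG Ga]] [b [G' FG' Gb]]; have [H FH [GH GH']] := F2 _ _ FG FG'.
  have [_ _ _ h] := FP _ FH; have [||z Hz] := h x y.
  + by exists a; apply: GH.
  + by exists b; apply: GH'.
  by exists z, H.
Qed.

Lemma embeds_square L : embeds nat L -> embeds (L * L) L.
Proof.
move=> [e einj].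
(* Starting from a pairing on the countable range of [e] keeps the domain of the maximal graph
   infinite. *)
pose G0 := range (fun n : nat * nat => (e n.1, e n.2, e (pickle n))).
have PG0 : square_graph G0.
  split.
  - by move=> p z z' [[a b] _ [<- <-]] [[c d] _ [/einj-> /einj-> <-]].
  - move=> p p' z [n _ [<- <-]] [m _ [<- /einj]].
    by move=> /(pcan_inj pickleK) ->.
  - move=> _ _ _ [[a b] _ [<- <- <-]]; split; eexists.
    + by exists (a, a).
    + by exists (b, b).
    + by exists (pickle (a, b), pickle (a, b)).
  - move=> x y [_ [[a a'] _ [<- _ _]]] [_ [[b b'] _ [<- _ _]]].
    by eexists; exists (a, b).
have [|G [G0G PG Gmax]] := Zorn_above PG0.
  by move=> F _; apply: square_graph_bigcup.
have [Gfun Ginj GD Gtot] := PG.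
pose D x := exists z, G (x, x, z).
pose A := {x | D x}.
have infA : embeds nat A.
  apply: (embeds_range einj) => n; exists (e (pickle (n, n))).
  by apply: G0G; exists (n, n).
have sqA : embeds (A * A) A.
  have /choice[f fP] (p : A * A) : exists z : A, G (sval p.1, sval p.2, sval z).
    case: p => -[x Dx] [y Dy]; have [z Gz] := Gtot _ _ Dx Dy.
    by have [_ _ Dz] := GD _ _ _ Gz; exists (exist _ z Dz).
  exists f => -[[x Dx] [y Dy]] [[x' Dx'] [y' Dy']] fe.
  have := fP (exist _ x Dx, exist _ y Dy); rewrite fe /= => g.
  have [xx yy] := Ginj _ _ _ g (fP (exist _ x' Dx', exist _ y' Dy')).
  by congr pair; apply: sval_inj.
have AL : embeds A L by apply: embeds_sig.
pose C := {x | ~ D x}.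
(* Either the complement of [D] is no larger than [A], and [L] embeds in [bool * A], hence in [A];
   or it contains a copy of [A], by which the graph can be enlarged. *)
have [CA|[g ginj]] := embeds_total C A.
  suff LA : embeds L A.
    by apply: embeds_trans (embeds_prod LA LA) _; apply: embeds_trans sqA AL.
  have [h hinj] := CA.
  apply: (@embeds_trans (bool * A)%type); last first.
    by apply: embeds_prod_self (embeds_refl A) => //; apply: embeds_count.
  exists (fun x => match pselect (D x) with
    left e => (true, exist _ x e) | right e => (false, h (exist _ x e)) end).
  by move=> x y; case: pselect => Dx; case: pselect => Dy // [] // /hinj [].
have [k kinj] : embeds (bool * A * (bool * A)) A.
  by do !apply: embeds_prod_self => //; try exact: embeds_count; exact: embeds_refl.
(* [pos] enumerates the enlarged domain: [D] under the flag [false], its copy under [true]. *)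
pose pos (w : bool * A) : L := if w.1 then sval (g w.2) else sval w.2.
have pos_inj : injective pos.
  move=> [b [x Dx]] [b' [y Dy]]; rewrite /pos /=.
  case: b; case: b' => //= xy.
  - by congr pair; apply/ginj/sval_inj.
  - by case: (g _) xy => z /= nDz zy; case: nDz; rewrite zy.
  - by case: (g _) xy => z /= nDz zy; case: nDz; rewrite -zy.
  - by congr pair; apply: sval_inj.
have posD w : D (pos w) <-> w.1 = false.
  case: w => -[] [x Dx]; rewrite /pos /=; last by split.
  by split=> //; case: (g _) => z.
(* Pairs with a member in the copy take their values in the copy, away from the old values, which
   lie in [D]. *)
pose new (p : bool * A * (bool * A)) : C := g (k p).
have new_inj p p' : sval (new p) = sval (new p') -> p = p'.
  by move=> /sval_inj/ginj/kinj.
pose G' := G `|` [set t | exists p, p.1.1 || p.2.1 /\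
   t = (pos p.1, pos p.2, sval (new p))].
have nDnew p : ~ D (sval (new p)) by case: (new p).
have DG' w : exists z, G' (pos w, pos w, z).
  case: w => -[] a; last first.
    have [z Gz] : D (pos (false, a)) by apply/posD.
    by exists z; left.
  by exists (sval (new ((true, a), (true, a)))); right; exists ((true, a), (true, a)).
have newpos p : sval (new p) = pos (true, k p) by [].
have nG p z : p.1.1 || p.2.1 -> ~ G (pos p.1, pos p.2, z).
  by move=> pb /GD[/posD p1 /posD p2 _]; rewrite p1 p2 in pb.
have PG' : square_graph G'.
  split.
  - move=> [x y] z z' [Gz|[p [pb [-> -> ->]]]] [Gz'|[q [qb]]].
    + exact: Gfun Gz Gz'.
    + by move=> [xE yE _]; case: (nG q z qb); rewrite -xE -yE.
    + by case: (nG p z' pb).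
    + move=> [/pos_inj p1 /pos_inj p2 ->].
      by rewrite [p]surjective_pairing p1 p2 -surjective_pairing.
  - move=> [x y] [x' y'] z [Gz|[p [pb [-> -> zp]]]] [Gz'|[q [qb [-> -> zq]]]].
    + exact: Ginj Gz Gz'.
    + by case: (nDnew q); rewrite -zq; case: (GD _ _ _ Gz).
    + by case: (nDnew p); rewrite -zp; case: (GD _ _ _ Gz').
    + by rewrite (new_inj p q) // -zp -zq.
  - move=> x y z [/GD[[a ha] [b hb] [c hc]]|[p [_ [-> -> ->]]]].
      by split; [exists a|exists b|exists c]; left.
    by rewrite newpos; split; apply: DG'.
  - have pos_onto x : (exists z, G' (x, x, z)) -> exists w, pos w = x.
      move=> [z [Gz|[p [_ [-> _ _]]]]]; last by exists p.1.
      by exists (false, exist _ x (ex_intro _ z Gz)).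
    move=> _ _ /pos_onto[v <-] /pos_onto[w <-].
    have [vw|] := boolP (v.1 || w.1).
      by exists (sval (new (v, w))); right; exists (v, w).
    rewrite negb_or => /andP[/negPf/posD Dv /negPf/posD Dw].
    by have [z Gz] := Gtot _ _ Dv Dw; exists z; left.
have G'G : G' `<=` G by apply: Gmax => //; apply: subsetUl.
have [a _] := infA.
have /G'G/GD[_ _] : G' (pos (true, a 0), pos (true, a 0),
    sval (new ((true, a 0), (true, a 0)))).
  by right; exists ((true, a 0), (true, a 0)).
by move=> /nDnew.
Qed.

(** * Countable powers of alephs *)

Lemma successor_pow K L : embeds nat K -> successor_cardinal K L ->
  embeds (nat -> K) L -> embeds (nat -> L) L.
Proof.
move=> infK /successor_embeds[nLK LJ] KL.
have infL : embeds nat L.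
  by have [/nLK//|] := embeds_total L K; apply: embeds_trans.
have sqL := embeds_square infL.
have [p pinj] : embeds (nat * K) K.
  exact: (embeds_prod_self (embeds_square infK) infK (embeds_refl K)).
have [k0 _] := infK; have {}k0 : K := k0 0.
pose small (S : set L) :=
  exists f : L -> K, forall x y, S x -> S y -> f x = f y -> x = y.
have smallP S : small S <-> embeds {x | S x} K.
  split=> [[f finj]|[f finj]].
    by exists (f \o sval) => -[x Sx] [y Sy] /= /finj xy; apply/sval_inj/xy.
  exists (fun x => if pselect (S x) is left e then f (exist _ x e) else k0).
  by move=> x y Sx Sy; case: pselect => // ?; case: pselect => // ? /finj [].
(* A maximal chain of sets of size at most |K| replaces the initial segments of an ordinal in
   Hausdorff's argument. *)
pose P (F : set (set L)) := F `<=` small /\ total_on F subset.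
have [|F [[Fsmall Ftot] Fmax]] := @Zorn_bigcup _ P.
  move=> Q QP Qtot; split=> [S [F QF FS]|S T [F QF FS] [G QG GT]].
    by have [h _] := QP _ QF; apply: h.
  have [FG|GF] := Qtot _ _ QF QG.
    by have [_ h] := QP _ QG; apply: h => //; apply: FG.
  by have [_ h] := QP _ QF; apply: h => //; apply: GF.
pose U := \bigcup_(S in F) S.
(* If [U] were small, adjoining one more point to it would extend the chain. As [L] is the successor
   of [K], it then embeds in [U]. *)
have nsmallU : ~ small U.
  move=> smU; have [x nUx] : exists x, ~ U x.
    apply: contrapT => h; apply: nLK;
    apply: embeds_trans (_ : embeds {x | U x} K); last exact/smallP.
    apply: (@embeds_range _ _ id) => // x; apply: contrapT => nUx.
    by apply: h; exists x.
  apply: (Fmax (F `|` [set U `|` [set x]])).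
    split=> [|h]; first exact: subsetUl.
    by apply: nUx; exists (U `|` [set x]); [apply: h|]; right.
  split=> [S [FS|->]|S T [FS|->] [FT|->]].
  - exact: Fsmall.
  - have [f finj] := smU.
    exists (fun y => if pselect (U y) is left _ then p (0, f y) else p (1, k0)).
    move=> y z Uy Uz; case: pselect => e; case: pselect => e' /pinj //.
      by move=> [/finj]; apply.
    by case: Uy e => // ->; case: Uz e' => // ->.
  - exact: Ftot.
  - by left=> y Sy; left; exists S.
  - by right=> y Sy; left; exists T.
  - by left.
pose UT := {x | U x}.
have LU : embeds L UT by apply: LJ => /smallP.
have /choice[T TP] (y : UT) : exists S, F S /\ S (sval y).
  by case: y => y [S FS Sy]; exists S.
(* Uncountable cofinality: countably many members of the chain have a small union, so some [y] of
   [U] lies outside it, and [T y] contains them all. *)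
have bound (s : nat -> UT) : exists y, forall i, T y (sval (s i)).
  pose V := \bigcup_i T (s i).
  have smV : small V.
    have /choice[f fP] i := Fsmall _ (TP (s i)).1.
    have /choice[j jP] x : exists i, V x -> T (s i) x.
      have [[i _ Tx]|nV] := pselect (V x); first by exists i.
      by exists 0.
    exists (fun x => p (j x, f (j x) x)) => x y Vx Vy /pinj [jxy].
    by rewrite jxy; apply: fP; [rewrite -jxy|]; apply: jP.
  have [y nV Uy] : exists2 y, ~ V y & U y.
    apply: contrapT => h; apply: nsmallU; have [f finj] := smV.
    have UV x : U x -> V x by move=> Ux; apply: contrapT => nV; apply: h; exists x.
    by exists f => x y /UV Vx /UV Vy; apply: finj.
  exists (exist _ y Uy) => i; have [Fy Ty] := TP (exist _ y Uy).
  have [Fi Ti] := TP (s i).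
  have [h|h] := Ftot _ _ Fi Fy; first exact: h.
  by case: nV; exists i => //; apply: h.
have /choice[b bP] := bound.
have /choice[f fP] y := Fsmall _ (TP y).1.
have [u0] : inhabited UT.
  by have [h _] := LU; have [e _] := infL; exact: (inhabits (h (e 0))).
apply: (@embeds_trans (nat -> UT)).
  have [e _] := infL.
  by apply: embeds_fun => //; [exact: embeds_refl|exact: (inhabits (e 0))].
apply: (@embeds_trans (UT * (nat -> K))); last first.
  exact: (embeds_prod_self sqL (embeds_sig _) KL).
(* A sequence is determined by its bound and by the names in [K] that its terms receive from the
   injection of [T (b s)]. *)
exists (fun s => (b s, fun i => f (b s) (sval (s i)))) => s t [bst].
rewrite bst => e; apply/funext => i; apply: sval_inj.
apply: (fP (b t)); [by rewrite -bst; apply: bP|exact: bP|].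
exact: (congr1 (fun w => w i) e).
Qed.

Lemma embeds_pow2 A B : embeds A B -> embeds (A -> bool) (B -> bool).
Proof. by move=> AB; exact: (embeds_fun AB (embeds_refl bool) (inhabits true)). Qed.

Lemma Cantor_bool K : ~ embeds (K -> bool) K.
Proof.
move=> h; apply: (@Cantor K); apply: embeds_trans h.
exists (fun (S : set K) x => `[< S x >]) => S T ST.
apply/funext => x; rewrite -[S x]asboolE -[T x]asboolE.
by rewrite (congr1 (fun w => w x) ST : `[< S x >] = _).
Qed.

(** The hypothesis bounds 2^omega by [L], hence by every type that does not embed in [K]; Cantor's
    theorem gives the other half. *)
Lemma aleph1_pow_CH L : is_aleph 1 L -> embeds (nat -> L) L -> CH.
Proof.
move=> L1 LL; have natL := is_aleph_infinite L1.
have [K [K0 /successor_embeds[nLK LJ]]] := L1.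
have [Knat natK] := card_eq_embeds K0.
have bL : embeds (nat -> bool) L.
  apply: embeds_trans LL; apply: embeds_fun; first exact: embeds_refl.
    exact: embeds_count.
  exact: (inhabits true).
exists K; split=> //; apply/successor_embeds; split.
  by move=> bK; apply: (@Cantor_bool nat); apply: embeds_trans bK Knat.
by move=> J /LJ; apply: embeds_trans.
Qed.

(** [successor_pow] climbs from each aleph to the next. At aleph_1 it needs omega^omega to be at
    most aleph_1, which follows from CH when functions are coded by their graphs. *)
Lemma CH_aleph_pow n L : CH -> 0 < n -> is_aleph n L -> embeds (nat -> L) L.
Proof.
move=> [K' [K'0 /successor_embeds[nbK' bJ]]].
case: n => // n _; elim: n L => [|n IH] L [K [Kn KL]]; last first.
  have [KK natK] := (IH _ Kn, is_aleph_infinite (Kn : is_aleph n.+1 K)).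
  apply: (successor_pow natK KL); apply: embeds_trans KK _.
  by have /successor_embeds[nLK _] := KL; have [] := embeds_total L K.
have [Knat natK] := card_eq_embeds Kn; have [K'nat natK'] := card_eq_embeds K'0.
apply: (successor_pow natK KL).
have /successor_embeds[nLK _] := KL.
apply: (@embeds_trans (nat -> bool)); last first.
  by apply: bJ => LK'; apply: nLK; apply: embeds_trans LK' (embeds_trans K'nat natK).
apply: (@embeds_trans (nat -> nat)).
  apply: embeds_fun => //; first exact: embeds_refl.
  by have [e _] := natK; exact: (inhabits (e 0)).
apply: (@embeds_trans (nat * nat -> bool)).
  exists (fun u q => u q.1 == q.2) => u v uv; apply/funext => i.
  by have := congr1 (fun w => w (i, u i)) uv; rewrite /= eqxx => /esym/eqP.
by apply: embeds_pow2; apply: embeds_count; apply: embeds_refl.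
Qed.

Lemma aleph_omega_infinite L : is_aleph_omega L -> embeds nat L.
Proof. by move=> [h _]; apply/card_le_embeds/(h 0)/card_eqxx. Qed.

Lemma is_aleph_embeds n J K : is_aleph n J -> is_aleph n K -> embeds J K.
Proof.
elim: n J K => [J K /card_eq_embeds[Jnat _] /card_eq_embeds[_ natK]|].
  exact: embeds_trans Jnat natK.
move=> n IH J K [J' [J'n /successor_embeds[_ JJ']]].
move=> [K' [K'n /successor_embeds[nKK' _]]].
apply: JJ' => KJ'; apply: nKK'; exact: embeds_trans KJ' (IH _ _ J'n K'n).
Qed.

(** König's diagonal argument along [L = sup_n aleph_n]. *)
Lemma aleph_omega_pow L : is_aleph_omega L -> ~ embeds (nat -> L) L.
Proof.
move=> [Lge Lle] [F Finj].
pose K n := projT1 (cid (is_aleph_exists n)).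
have Kn n : is_aleph n (K n) by apply: projT2 (cid (is_aleph_exists n)).
have [g ginj] : embeds L {n & K n}.
  apply/card_le_embeds/Lle => n J Jn; apply/card_le_embeds.
  apply: embeds_trans (is_aleph_embeds Jn (Kn n)) _.
  exists (existT K n) => x y e.
  by rewrite -[y](projT2_eq e) (eq_irrelevance (projT1_eq e) erefl).
have nLK n : ~ embeds L (K n).
  move=> LK; have [K' [K'n /successor_embeds[nK _]]] := Kn n.+1.
  apply: nK; apply: embeds_trans (is_aleph_embeds (Kn n) K'n).
  by apply: embeds_trans LK; apply/card_le_embeds/Lge.
(* The sequences coded in the n-th summand take at most aleph_n values at [n], too few to fill
   [L]. *)
have diag n : exists x, forall (k : K n) s, g (F s) = existT K n k -> s n <> x.
  apply: contrapT => h; apply: (nLK n).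
  have /choice[r rP] x : exists (k : K n) , exists2 s, g (F s) = existT K n k & s n = x.
    apply: contrapT => nk; apply: h; exists x => k s gFs sn.
    by apply: nk; exists k, s.
  exists r => x y rxy; have [s gs <-] := rP x; have [t gt <-] := rP y.
  by congr (_ n); apply/Finj/ginj; rewrite gs gt rxy.
have /choice[s sP] := diag.
by case E : (g (F s)) => [n k]; apply: (sP n k s).
Qed.

(** * Abelian groups *)

Local Open Scope ring_scope.
Local Open Scope quotient_scope.

(** * Integer combinations by reflection *)

Inductive zexp : Type :=
| ZVar of nat | ZZero | ZAdd of zexp & zexp | ZOpp of zexp | ZMul of zexp & int.

Fixpoint zeval (V : zmodType) (env : seq V) (e : zexp) : V :=
  match e with
  | ZVar i => env`_i
  | ZZero => 0
  | ZAdd e1 e2 => zeval env e1 + zeval env e2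
  | ZOpp e1 => - zeval env e1
  | ZMul e1 z => zeval env e1 *~ z
  end.

Fixpoint zcoef (e : zexp) (i : nat) : int :=
  match e with
  | ZVar j => if eqn i j then 1 else 0
  | ZZero => 0
  | ZAdd e1 e2 => zcoef e1 i + zcoef e2 i
  | ZOpp e1 => - zcoef e1 i
  | ZMul e1 z => zcoef e1 i * z
  end.

Lemma zeval_coef (V : zmodType) (env : seq V) e :
  zeval env e = \sum_(i < size env) env`_i *~ zcoef e i.
Proof.
elim: e => [j||e1 IH1 e2 IH2|e IH|e IH z] /=.
- have [jn|nj] := ltnP j (size env).
    rewrite (bigD1 (Ordinal jn)) //= -[eqn j j]/(j == j) eqxx big1 ?addr0 // => i.
    by rewrite -val_eqE -[eqn i j]/(val i == j) /= => /negPf->.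
  rewrite nth_default // big1 // => i _.
  rewrite -[eqn i j]/(nat_of_ord i == j) ltn_eqF //.
  exact: leq_trans nj.
- by rewrite big1 // => i _; rewrite mulr0z.
- by rewrite IH1 IH2 -big_split; apply: eq_bigr => i _; rewrite mulrzDr.
- by rewrite IH -sumrN; apply: eq_bigr => i _; rewrite mulrNz.
- by rewrite IH mulrz_suml; apply: eq_bigr => i _; rewrite mulrzA.
Qed.

Fixpoint zagree (n : nat) (e1 e2 : zexp) : Prop :=
  if n is m.+1 then zcoef e1 m = zcoef e2 m /\ zagree m e1 e2 else True.

Lemma zeval_eq (V : zmodType) (env : seq V) e1 e2 :
  zagree (size env) e1 e2 -> zeval env e1 = zeval env e2.
Proof.
move=> e12; rewrite !zeval_coef; apply: eq_bigr => -[i] /= + _.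
elim: (size env) e12 => //= n IH [en /IH{}IH]; rewrite ltnS leq_eqVlt.
by move=> /predU1P[->|/IH//]; rewrite en.
Qed.

(* Atoms are compared up to conversion, as canonical structures may be
   inferred along different paths. *)
Ltac zmod_index x env :=
  match env with
  | ?y :: _ => let u := match goal with _ => unify x y end in constr:(0%N)
  | _ :: ?l => let n := zmod_index x l in constr:(S n)
  end.

Ltac zmod_atoms env t :=
  lazymatch t with
  | (?a + ?b)%R => let env := zmod_atoms env a in zmod_atoms env b
  | (- ?a)%R => zmod_atoms env a
  | (?a *+ ?n)%R => zmod_atoms env a
  | (?a *~ ?z)%R => zmod_atoms env a
  | 0%R => env
  | _ => match env with
    | _ => let n := zmod_index t env in env
    | _ => constr:(t :: env)
    end
  end.

Ltac zmod_reify env t :=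
  lazymatch t with
  | (?a + ?b)%R => let a := zmod_reify env a in
                   let b := zmod_reify env b in constr:(ZAdd a b)
  | (- ?a)%R => let a := zmod_reify env a in constr:(ZOpp a)
  | (?a *+ ?n)%R => let a := zmod_reify env a in constr:(ZMul a (Posz n))
  | (?a *~ ?z)%R => let a := zmod_reify env a in constr:(ZMul a z)
  | 0%R => constr:(ZZero)
  | _ => let n := zmod_index t env in constr:(ZVar n)
  end.

(* Two integer combinations are equal as soon as the coefficients of each atom
   agree as (possibly symbolic) integers, which is left to [ring]. *)
Ltac zmod :=
  lazymatch goal with
  | |- @eq ?T ?x ?y =>
    let env := zmod_atoms (@nil T) x in
    let env := zmod_atoms env y in
    let e1 := zmod_reify env x in
    let e2 := zmod_reify env y in
    apply: (@zeval_eq _ env e1 e2); cbn [zagree zcoef size eqn];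
    rewrite ?PoszM; do !split; ring
  end.

(** * Subgroups and quotients *)

Definition zmod_set (V : zmodType) (S : set V) : Prop :=
  S 0 /\ forall x y, S x -> S y -> S (x - y).

Section ZmodSet.
Context (V : zmodType) (S : set V) (hS : zmod_set S).

Lemma zmod_setN x : S x -> S (- x).
Proof. by move=> Sx; rewrite -sub0r; apply: hS.2 => //; apply: hS.1. Qed.

Lemma zmod_setD x y : S x -> S y -> S (x + y).
Proof. by move=> Sx /zmod_setN Sy; rewrite -[y]opprK; apply: hS.2. Qed.

Lemma zmod_setMn x n : S x -> S (x *+ n).
Proof.
move=> Sx; elim: n => [|n IH]; first by rewrite mulr0n; apply: hS.1.
by rewrite mulrS; apply: zmod_setD.
Qed.

Lemma zmod_setMz x z : S x -> S (x *~ z).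
Proof.
move=> Sx; case: z => n; first exact: zmod_setMn.
by apply: zmod_setN; apply: zmod_setMn.
Qed.

Definition closed_of of zmod_set S : V -> bool := fun x => `[< S x >].

Fact closed_of_zmod_closed : zmod_closed (closed_of hS).
Proof.
split=> [|x y]; rewrite /in_mem /= /closed_of; first by apply/asboolP; apply: hS.1.
by move=> /asboolP Sx /asboolP Sy; apply/asboolP; apply: hS.2.
Qed.

HB.instance Definition _ :=
  GRing.isZmodClosed.Build V (closed_of hS) closed_of_zmod_closed.

(** Subgroups are built as sets, to which Zorn's lemma applies; this turns them into the structure
    from which subgroup types and quotients are formed. *)
Definition zmodClosed_of : zmodClosed V :=
  GRing.ZmodClosed.clone V (closed_of hS) _.

Lemma zmodClosed_ofP x : reflect (S x) (x \in zmodClosed_of).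
Proof. exact: asboolP. Qed.

End ZmodSet.

Lemma zmod_set_bigcup (V : zmodType) (F : set (set V)) : F !=set0 ->
  F `<=` @zmod_set V -> total_on F subset -> zmod_set (\bigcup_(X in F) X).
Proof.
move=> [X FX] FP Ftot; split; first by exists X => //; case: (FP _ FX).
move=> x y [Y FY Yx] [Z FZ Zy]; have [YZ|ZY] := Ftot _ _ FY FZ.
  by exists Z => //; apply: (FP _ FZ).2 => //; apply: YZ.
by exists Y => //; apply: (FP _ FY).2 => //; apply: ZY.
Qed.

Lemma additive_exists (U V : zmodType) (f : U -> V) : zmod_morphism f ->
  exists g : {additive U -> V}, g =1 f.
Proof.
move=> hf; pose fA := GRing.isZmodMorphism.Build U V f hf.
by exists (HB.pack_for {additive U -> V} f fA).
Qed.

Section Quot.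
Context (V : zmodType) (I : zmodClosed V).

(** Quotients are handled below only through such a surjection and its kernel. *)
Lemma quot_proj : exists p : {additive V -> Quotient.quot I},
  (forall y, exists x, p x = y) /\ forall x, p x = 0 <-> x \in I.
Proof.
have [|p pE] := @additive_exists _ _ (\pi_(Quotient.quot I) : V -> _).
  by move=> x y; rewrite raddfB.
exists p; split=> [y|x]; first by exists (repr y); rewrite pE reprK.
rewrite pE -[X in X \in I]subr0 Quotient.idealrBE.
by split=> [->|/eqP->]; rewrite ?raddf0.
Qed.

End Quot.

Lemma int_zmod_set (I : set int) : zmod_set I ->
  exists2 d : int, I d & forall z, I z -> exists q, z = q * d.
Proof.
move=> hI; have [[n In]|nI] := pselect (exists n : nat, I n.+1%:Z); last first.
  exists 0; [exact: hI.1|move=> z Iz; exists 0; rewrite mul0r].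
  case: z Iz => [[//|n] In|n In]; first by case: nI; exists n.
  by case: nI; exists n; rewrite -[_%:Z]opprK; apply: zmod_setN.
pose P m := `[< I m.+1%:Z >].
have exP : exists m, P m by exists n; apply/asboolP.
case: (ex_minnP exP) => m /asboolP Im mmin; exists m.+1%:Z => // z Iz.
exists (z %/ m.+1)%Z.
have Ir : I (z %% m.+1)%Z.
  rewrite /modz; apply: hI.2 => //.
  by rewrite mulrC -[_ * _]mulrzz; apply: zmod_setMz.
rewrite {1}(divz_eq z m.+1).
have : (0 <= (z %% m.+1)%Z < m.+1%:Z)%R by rewrite modz_ge0 ?ltz_pmod.
move: Ir; case: (z %% m.+1)%Z => // -[|r] Ir; first by rewrite addr0.
rewrite ltz_nat ltnS => /andP[_ rm].
by have := mmin r; rewrite /P; move/asboolP : Ir => -> /(_ isT); rewrite leqNgt rm.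
Qed.

(** * Ext(G, Z^omega / Z^(omega)) = 0 iff G is torsion-free *)

Lemma finite_suppP (T : zmodType) (u : nat -> T) :
  finite_set [set n | u n != 0] <-> exists N, forall j, (N <= j)%N -> u j = 0.
Proof.
split=> [/finite_seqP[s sE]|[N uN]].
  exists (\max_(i <- s) i).+1 => j; apply: contraTeq => uj.
  have : [set n | u n != 0] j by [].
  by rewrite sE -leqNgt => /= js; apply: (@leq_bigmax_seq _ _ xpredT id).
apply: (@sub_finite_set _ _ `I_N); last exact: finite_II.
by move=> j /=; apply: contra_neqT; rewrite -leqNgt; apply: uN.
Qed.

Lemma ZomegaModSum_proj : exists p : {additive (nat -> int) -> ZomegaModSum},
  (forall y, exists x, p x = y) /\
  forall u, p u = 0 <-> exists N, forall j, (N <= j)%N -> u j = 0.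
Proof.
have [p [psurj p0]] := quot_proj (GRing.ZmodClosed.clone (nat -> int) finsupp_seq _).
exists p; split=> // u; rewrite -finite_suppP; apply: iff_trans (p0 u) _.
by split=> /asboolP.
Qed.

Lemma fct_mulz (I : Type) (V : zmodType) (u : I -> V) z i : (u *~ z) i = u i *~ z.
Proof.
have [//|ev evE] := @additive_exists (I -> V) V (fun v => v i).
by rewrite -[LHS]evE raddfMz evE.
Qed.

(** Each coordinate [j] only has to satisfy the equations of index at most [j],
    which can be solved downwards from [0]. *)
Lemma ZomegaModSum_solve (k : nat -> int) (a : nat -> ZomegaModSum) :
  exists x, forall n, x n = x n.+1 *~ k n + a n.
Proof.
have [p [psurj p0]] := ZomegaModSum_proj.
have /choice[c cP] n := psurj (a n).
(* The fuel [m] counts the equations left at coordinate [j]: it is j + 1 - n at index [n], so the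
   value at index j + 1 is 0. *)
pose fix y m j n {struct m} : int := if m is m'.+1 then y m' j n.+1 * k n + c n j else 0.
exists (fun n => p (fun j => y (j.+1 - n)%N j n)) => n.
apply/eqP; rewrite -subr_eq0 -cP -raddfMz -raddfD -raddfB; apply/eqP/p0.
exists n => j nj.
rewrite -[LHS]/(y (j.+1 - n)%N j n -
  ((fun j => y (j.+1 - n.+1)%N j n.+1) *~ k n + c n) j).
rewrite -[X in _ - X]/(((fun j => y (j.+1 - n.+1)%N j n.+1) *~ k n) j + c n j).
by rewrite fct_mulz subSS subSn //= mulrzz subrr.
Qed.

(** * Extensions of torsion-free groups split *)

Definition torsion_free (G : zmodType) : Prop :=
  forall (x : G) n, (0 < n)%N -> x *+ n = 0 -> x = 0.

Section Complement.
Context (A B G : zmodType) (i : {additive A -> B}) (p : {additive B -> G}).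
Hypotheses (p0 : forall b, p b = 0 <-> exists a, i a = b).
Hypothesis tfG : torsion_free G.
Hypothesis solveA : forall (k : nat -> int) (a : nat -> A),
  exists x, forall n, x n = x n.+1 *~ k n + a n.

Let C (S : set B) : set B := [set b | exists a, S (b - i a)].

(** Partial complements of [i A]. Here [C S] is S + i A, and its purity makes division unique modulo
    [C S]. *)
Let good (S : set B) : Prop :=
  [/\ zmod_set S, forall a, S (i a) -> i a = 0
    & forall b n, (0 < n)%N -> C S (b *+ n) -> C S b].

Let C_zmod S : zmod_set S -> zmod_set (C S).
Proof.
move=> hS; split=> [|x y [a Sa] [b Sb]].
  by exists 0; rewrite raddf0 subr0; apply: hS.1.
exists (a - b); have -> : x - y - i (a - b) = (x - i a) - (y - i b).
  by rewrite raddfB; zmod.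
exact: hS.2.
Qed.

Let C_sub S b : zmod_set S -> S b -> C S b.
Proof. by exists 0; rewrite raddf0 subr0. Qed.

Let C_im S a : zmod_set S -> C S (i a).
Proof. by move=> hS; exists a; rewrite subrr; apply: hS.1. Qed.

Let C_mulz S b z : good S -> z != 0 -> C S (b *~ z) -> C S b.
Proof.
move=> [hS _ pS]; case: z => n; first by case: n => // n _; apply: pS.
move=> _ /(zmod_setN (C_zmod hS)); rewrite opprK; exact: pS.
Qed.

(** For S = 0, [C S] is i A = ker p, which is pure because [G] is torsion-free. *)
Lemma good0 : good [set 0].
Proof.
split=> [|//|b n n0 [a /eqP]].
  by split=> // x y -> ->; rewrite subrr.
rewrite subr_eq0 => /eqP bn; have /p0[c <-] : p b = 0; last first.
  by exists c; rewrite subrr.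
by apply: (tfG n0); rewrite -raddfMn; apply/p0; exists a.
Qed.

Lemma good_bigcup (F : set (set B)) : F !=set0 ->
  F `<=` good -> total_on F subset -> good (\bigcup_(X in F) X).
Proof.
move=> F0 FP Ftot; split.
- by apply: zmod_set_bigcup => // X /FP[].
- by move=> a [X /FP[_ h _] Xa]; apply: h.
- move=> b n n0 [a [X FX Xa]]; have [_ _ h] := FP _ FX.
  by have [|c Xc] := h b n n0; [exists a|exists c; exists X].
Qed.

Section Step.
Variables (S : set B) (b : B).
Hypotheses (gS : good S) (nb : ~ C S b).

Let hS : zmod_set S. Proof. by case: gS. Qed.
Let hC : zmod_set (C S) := C_zmod hS.

(** The numerators j for which the fraction b j / n! exists in [B] modulo S + i A. *)
Let J n : set int := [set j | exists x, C S (x *+ n`! - b *~ j)].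

Let J_zmod n : zmod_set (J n).
Proof.
split=> [|j j' [x Cx] [y Cy]].
  by exists 0; rewrite mul0rn mulr0z subr0; apply: hC.1.
exists (x - y).
have -> : (x - y) *+ n`! - b *~ (j - j') = (x *+ n`! - b *~ j) - (y *+ n`! - b *~ j').
  by zmod.
exact: hC.2.
Qed.

(** Modulo [C S], the pure closure of [b] is the increasing union of the cyclic groups generated by
    the [h n], where [h n] is the fraction d n / n! of [b] and [d n] generates [J n]. *)
Let chain : exists (d : nat -> int) (h : nat -> B) (k : nat -> int),
  [/\ forall n, d n != 0, forall n, C S (h n *+ n`! - b *~ d n),
      forall n z, J n z -> exists q, z = q * d n
    & forall n, C S (h n - h n.+1 *~ k n)].
Proof.
have /choice[d dP] n : exists d, J n d /\ forall z, J n z -> exists q, z = q * d.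
  by have [d Jd dP] := int_zmod_set (J_zmod n); exists d.
have /choice[h hP] n := (dP n).1.
have dgen n := (dP n).2.
have hk n : exists k, C S (h n - h n.+1 *~ k).
  have [|k kP] := dgen n.+1 (d n * n.+1%:Z).
    exists (h n).
    have -> : h n *+ (n.+1)`! - b *~ (d n * n.+1%:Z) = (h n *+ n`! - b *~ d n) *+ n.+1.
      by rewrite factS; zmod.
    exact: zmod_setMn.
  exists k; have [_ _ pS] := gS; apply: (pS _ n.+1`!); first exact: fact_gt0.
  have -> : (h n - h n.+1 *~ k) *+ (n.+1)`! =
      (h n *+ n`! - b *~ d n) *+ n.+1 - (h n.+1 *+ (n.+1)`! - b *~ d n.+1) *~ k.
    apply/eqP; rewrite -subr_eq0; apply/eqP.
    transitivity (b *~ (d n * n.+1%:Z - k * d n.+1)); first by rewrite factS; zmod.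
    by rewrite kP subrr mulr0z.
  apply: hC.2; first exact: zmod_setMn.
  exact: zmod_setMz.
have /choice[k kP] := hk.
exists d, h, k; split=> // n; apply/eqP => dn0.
have [|q] := dgen n (n`!%:Z).
  by exists b; rewrite subrr; apply: hC.1.
by rewrite dn0 mulr0 => /eqP; rewrite eqz_nat -leqn0 leqNgt fact_gt0.
Qed.

(** The [h n] fit together modulo [S] only up to elements [a n] of [A]. Correcting them by a
    solution [x] of the equations in [A] gives elements [e n] that fit together modulo [S] itself;
    these and [S] generate the larger partial complement. *)
Lemma good_step : exists2 S', good S' /\ S `<=` S' & exists2 e, S' e & ~ S e.
Proof.
have [d [h [k [d0 hb dgen /choice[a aP]]]]] := chain.
have [x xP] := solveA k a.
pose e n := h n - i (x n).
have eS n : S (e n - e n.+1 *~ k n).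
  suff -> : e n - e n.+1 *~ k n = h n - h n.+1 *~ k n - i (a n) by [].
  by rewrite /e {1}xP raddfD raddfMz; zmod.
have he n : C S (h n - e n).
  have -> : h n - e n = i (x n) by rewrite /e; zmod.
  exact: C_im.
have Ch n : ~ C S (h n).
  move=> Chn; apply: nb; apply: (C_mulz gS (d0 n)).
  have -> : b *~ d n = h n *+ n`! - (h n *+ n`! - b *~ d n) by zmod.
  by apply: hC.2 => //; apply: zmod_setMn.
pose T n : set B := [set y | exists z, S (y - e n *~ z)].
have T_le m n y : (m <= n)%N -> T m y -> T n y.
  move=> /subnK <-; elim: (n - m)%N => // l IH /IH[z Sz]; rewrite addSn.
  exists (z * k (l + m)%N).
  have -> : y - e (l + m).+1 *~ (z * k (l + m)%N) =
    (y - e (l + m)%N *~ z) + (e (l + m)%N - e (l + m).+1 *~ k (l + m)%N) *~ z by zmod.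
  by apply: zmod_setD => //; apply: zmod_setMz.
have hT n : zmod_set (T n).
  split=> [|y y' [z Sz] [z' Sz']].
    by exists 0; rewrite mulr0z subr0; apply: hS.1.
  exists (z - z'); have -> : y - y' - e n *~ (z - z') = (y - e n *~ z) - (y' - e n *~ z').
    by zmod.
  exact: hS.2.
have TC n y : T n y -> exists z, C S (y - h n *~ z).
  move=> [z Sz]; exists z.
  have -> : y - h n *~ z = y - e n *~ z - (h n - e n) *~ z by zmod.
  by apply: hC.2; [exact: C_sub|apply: zmod_setMz].
exists (\bigcup_n T n); last first.
  exists (e 0%N).
    by exists 0%N => //; exists 1; rewrite subrr; apply: hS.1.
  move=> Se; apply: (Ch 0%N); have -> : h 0%N = (h 0%N - e 0%N) + e 0%N by zmod.
  by apply: zmod_setD => //; apply: C_sub.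
split; last by move=> y Sy; exists 0%N => //; exists 0; rewrite mulr0z subr0.
split.
- split=> [|y y' [m _ Ty] [n _ Ty']]; first by exists 0%N => //; apply: (hT _).1.
  exists (maxn m n) => //; apply: (hT _).2.
    by apply: T_le Ty; apply: leq_maxl.
  by apply: T_le Ty'; apply: leq_maxr.
- move=> c [n _ [z Sz]]; have [z0|z0] := eqVneq z 0.
    by move: Sz; rewrite z0 mulr0z subr0; case: gS => _ h0 _; apply: h0.
  case: (Ch n); apply: (C_mulz gS z0).
  have -> : h n *~ z = i c - (i c - e n *~ z) + (h n - e n) *~ z by zmod.
  apply: zmod_setD => //; last exact: zmod_setMz.
  by apply: hC.2; [exact: C_im|exact: C_sub].
- move=> y m m0 [c [n _ /TC[z Cz]]].
  (* m n! divides N!, so [y], modulo [C S] a fraction of [b] with denominator m n!, is a multiple of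
     [h N] there. *)
  pose N := (m + n)%N.
  have [t tE] : exists t, N`! = (m * n`! * t)%N.
    have /dvdnP[r rE] : (m %| m`!)%N by apply: dvdn_fact; rewrite m0 leqnn.
    exists ('C(N, m) * r)%N; rewrite -(bin_fact (leq_addr n m)) addKn rE.
    by rewrite -/N; ring.
  have yC : C S (y *+ N`! - b *~ (d n * z * t)).
    have -> : y *+ N`! - b *~ (d n * z * t) =
      ((y *+ m - i c - h n *~ z) + i c) *+ (n`! * t) + (h n *+ n`! - b *~ d n) *~ (z * t).
      by rewrite tE; zmod.
    apply: zmod_setD => //; last exact: zmod_setMz.
    by apply: zmod_setMn => //; apply: zmod_setD => //; apply: C_im.
  have [q qE] : exists q, d n * z * t = q * d N by apply: dgen; exists y.
  have [c' Sc'] : C S (y - h N *~ q).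
    have [_ _ pS] := gS; apply: (pS _ N`!); first exact: fact_gt0.
    have -> : (y - h N *~ q) *+ N`! =
      y *+ N`! - b *~ (d n * z * t) - (h N *+ N`! - b *~ d N) *~ q.
      by rewrite qE; zmod.
    by apply: hC.2 => //; apply: zmod_setMz.
  exists (c' + x N *~ q), N => //; exists q.
  suff -> : y - i (c' + x N *~ q) - e N *~ q = y - h N *~ q - i c' by [].
  by rewrite raddfD raddfMz /e; zmod.
Qed.

End Step.

Lemma complement_exists : exists S : set B,
  [/\ zmod_set S, forall a, S (i a) -> i a = 0 & forall b, exists a, S (b - i a)].
Proof.
have [S [_ gS Smax]] := Zorn_above good0 good_bigcup.
have [hS S0 _] := gS; exists S; split=> // b.
apply: contrapT => nb; have [T [gT ST] [e Te nSe]] := good_step gS nb.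
by apply: nSe; apply: Smax ST gT _ Te.
Qed.

End Complement.

Lemma torsion_free_perp (G : zmodType) : torsion_free G -> perp ZomegaModSum G.
Proof.
move=> tfG [B i p i_inj p_surj p_exact].
have [S [hS S0 SC]] := complement_exists p_exact tfG ZomegaModSum_solve.
have {}S0 a : S (i a) -> a = 0 by move=> /S0 e; apply: i_inj; rewrite e raddf0.
(* [r] is the projection onto [A] along [S]; together with [p] it splits the extension. *)
have /choice[r rP] := SC.
have r_uniq b a : S (b - i a) -> r b = a.
  move=> Sa; apply/eqP; rewrite -subr_eq0; apply/eqP/S0.
  have -> : i (r b - a) = (b - i a) - (b - i (r b)) by rewrite raddfB; zmod.
  exact: hS.2.
have [|phi phiE] := @additive_exists B (ZomegaModSum * G)%type (fun b => (r b, p b)).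
  move=> b b'; congr pair; last by rewrite raddfB.
  apply: r_uniq; have -> : b - b' - i (r b - r b') = (b - i (r b)) - (b' - i (r b')).
    by rewrite raddfB; zmod.
  exact: hS.2.
exists phi; split=> /=; last by move=> b; rewrite phiE.
- have inj_phi : injective phi.
    move=> b b'; rewrite !phiE => -[rb /eqP].
    rewrite -subr_eq0 -raddfB => /eqP/p_exact[c cE].
    apply/eqP; rewrite -subr_eq0 -cE (S0 c) ?raddf0 //.
    have -> : i c = (b - i (r b)) - (b' - i (r b')) by rewrite cE rb; zmod.
    exact: hS.2.
  have surj_phi q : exists b, phi b = q.
    case: q => a g; have [b bg] := p_surj g; exists (b - i (r b) + i a).
    rewrite phiE; congr pair.
      by apply: r_uniq; rewrite addrK.
    have pi0 c : p (i c) = 0 by apply/p_exact; exists c.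
    by rewrite raddfD raddfB !pi0 subr0 addr0.
  have /choice[s sP] := surj_phi.
  by exists s; [apply: inj_can_sym|].
- move=> a; rewrite phiE; congr pair.
    by apply: r_uniq; rewrite subrr; apply: hS.1.
  by apply/p_exact; exists a.
Qed.

(** * Torsion yields a non-split extension *)

Definition divisible (D : zmodType) : Prop :=
  forall (y : D) n, (0 < n)%N -> exists t, t *+ n = y.

Lemma pair_mulz (U V : zmodType) (u : U) (v : V) z :
  (u, v) *~ z = (u *~ z, v *~ z).
Proof. by rewrite [LHS]surjective_pairing (raddfMz fst) (raddfMz snd). Qed.

Section Pullback.
Context (A G D : zmodType) (j : {additive A -> D}) (g : G) (k : nat) (a1 : A).
Hypotheses (j_inj : injective j) (divD : divisible D).
Hypotheses (k_gt0 : (0 < k)%N) (gk0 : g *+ k = 0)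
  (gk : forall z, g *~ z = 0 -> exists q, z = q * k%:Z).

Let good (E : set (G * D)) : Prop :=
  zmod_set E /\ forall y, E (0, y) <-> exists a, j a = y.

(** A maximal [E] projects onto [G], as [D] is divisible, and is then an
    extension of [G] by [A]. *)
Lemma torsion_subgroup : exists E : set (G * D),
  [/\ zmod_set E, forall y, E (0, y) <-> exists a, j a = y,
      forall x, exists y, E (x, y)
    & exists2 t, E (g, t) & t *+ k = j a1].
Proof.
have [t tk] := divD (j a1) k_gt0.
(* The subgroup generated by (g, t) and 0 x j A. If g z = 0, then z is a multiple of [k] and t z one
   of j a1, so the fibre over 0 is still j A. *)
pose E0 : set (G * D) := [set p | exists z a, p = (g *~ z, t *~ z + j a)].
have gE0 : good E0.
  split.
    split=> [|_ _ [z [a ->]] [z' [a' ->]]].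
      by exists 0, 0; rewrite !mulr0z raddf0 addr0.
    exists (z - z'), (a - a'); congr pair; first by rewrite /=; zmod.
    by rewrite raddfB /=; zmod.
  move=> y; split=> [[z [a [/esym/gk[q ->] ->]]]|[a <-]].
    exists (a1 *~ q + a); rewrite raddfD raddfMz -tk; zmod.
  by exists 0, a; rewrite !mulr0z add0r.
have [E [E0E [hE jE] Emax]] : exists E, [/\ E0 `<=` E, good E &
    forall E', E `<=` E' -> good E' -> E' `<=` E].
  apply: Zorn_above gE0 _ => F F0 FP Ftot; split.
    by apply: zmod_set_bigcup => // X /FP[].
  move=> y; split=> [[X FX Xy]|[a jay]]; first by have [_ h] := FP _ FX; apply/h.
  have [X FX] := F0; exists X => //; have [_ h] := FP _ FX; apply/h; by exists a.
exists E; split=> //; last first.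
  exists t => //; apply: E0E; exists 1, 0; by rewrite raddf0 addr0.
move=> b; pose I : set int := [set z | exists y, E (b *~ z, y)].
have hI : zmod_set I.
  split=> [|z z' [y Ey] [y' Ey']].
    by exists 0; rewrite mulr0z; apply: hE.1.
  exists (y - y'); have -> : (b *~ (z - z'), y - y') = (b *~ z, y) - (b *~ z', y').
    by congr pair; rewrite /=; zmod.
  exact: hE.2.
have [d [u Eu] Id] := int_zmod_set hI.
(* [d] generates the multiples of [b] already covered by [E]. Dividing by [d] an element paired with
   d b gives a [v] such that adjoining (b, v) leaves the fibre over 0 unchanged; for d = 0 the
   choice is 0. *)
have [v [w wE Ew]] : exists v, exists2 w, v *~ d = w & E (b *~ d, w).
  have [d0|d0] := eqVneq d 0.
    by exists 0, 0; rewrite ?mul0rz // d0 mulr0z; apply: hE.1.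
  have dgt0 : (0 < `|d|)%N by rewrite absz_gt0.
  have [s sd] := divD u dgt0.
  case: d {d0 Id dgt0} sd Eu => n sd Eu; first by exists s, u.
  by exists (- s), u => //; rewrite -sd -[RHS]/(s *+ n.+1) NegzE; zmod.
pose E' : set (G * D) := [set p | exists z, E (p.1 - b *~ z, p.2 - v *~ z)].
have E'E : E' `<=` E.
  apply: Emax; first by move=> [x y] Exy; exists 0; rewrite !mulr0z !subr0.
  split.
    split=> [|p p' [z Ez] [z' Ez']].
      by exists 0; rewrite !mulr0z !subr0; apply: hE.1.
    exists (z - z'); have -> : ((p - p').1 - b *~ (z - z'), (p - p').2 - v *~ (z - z')) =
      (p.1 - b *~ z, p.2 - v *~ z) - (p'.1 - b *~ z', p'.2 - v *~ z').
      by congr pair; rewrite /=; zmod.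
    exact: hE.2.
  move=> y; split=> [[z /= Ez]|/jE Ey]; last first.
    by exists 0; rewrite !mulr0z !subr0.
  have [q qE] : exists q, z = q * d.
    apply: Id; exists (v *~ z - y).
    have -> : (b *~ z, v *~ z - y) = - (0 - b *~ z, y - v *~ z).
      by congr pair; rewrite /=; zmod.
    exact: zmod_setN.
  apply/jE; have -> : (0, y) = (0 - b *~ z, y - v *~ z) + (b *~ d, w) *~ q.
    rewrite pair_mulz -wE -!mulrzA ![d * q]mulrC -qE.
    by congr pair; rewrite /=; zmod.
  by apply: zmod_setD => //; apply: zmod_setMz.
exists v; apply: E'E; exists 1 => /=; rewrite !mulr1z !subrr; exact: hE.1.
Qed.

(** The middle group is [E], and (g, t) is the lift of [g]: its multiple by [k] is (0, j a1). *)
Lemma torsion_extension : exists (E : extension G A) (e : ext_mid E),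
  ext_out E e = g /\ e *+ k = ext_in E a1.
Proof.
have [E [hE jE Esurj [t Et tk]]] := torsion_subgroup.
pose M : zmodType := subgroup (zmodClosed_of hE).
have ME (p : G * D) : E p -> p \in zmodClosed_of hE by move=> Ep; apply/zmodClosed_ofP.
have jM a : E (0, j a) by apply/jE; exists a.
have [|i iE] := @additive_exists A M (fun a => Subgroup (ME _ (jM a))).
  move=> a b; apply: val_inj; rewrite /= raddfB.
  by congr pair; rewrite subrr.
have [//|o oE] := @additive_exists M G (fun m => (val m).1).
have i_inj : injective i.
  by move=> a b; rewrite !iE => -[/j_inj].
have o_surj x : exists m, o m = x.
  have [y Exy] := Esurj x; exists (Subgroup (ME _ Exy)).
  by rewrite oE.
have i_o m : o m = 0 <-> exists a, i a = m.
  rewrite oE; split=> [|[a <-]]; last by rewrite iE.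
  case: m => -[x y] Exy /= x0.
  have /jE[a ja] : E (0, y) by rewrite -x0; apply/zmodClosed_ofP.
  by exists a; rewrite iE; apply: val_inj; rewrite /= ja x0.
exists (Extension i_inj o_surj i_o), (Subgroup (ME _ Et)); rewrite /= oE; split=> //.
rewrite iE; apply: val_inj; rewrite raddfMn /= pmulrn pair_mulz -tk.
by congr pair; rewrite -pmulrn.
Qed.

End Pullback.

(** At [rat], this is the divisible group into which Z^omega / Z^(omega) is embedded. *)
Lemma product_mod_sum (V : zmodType) :
  exists (D : zmodType) (p : {additive (nat -> V) -> D}),
  (forall y, exists x, p x = y) /\
  forall u, p u = 0 <-> exists N, forall j, (N <= j)%N -> u j = 0.
Proof.
have hS : zmod_set [set u : nat -> V | exists N, forall j, (N <= j)%N -> u j = 0].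
  split=> [|u v [m um] [n vn]]; first by exists 0%N.
  exists (maxn m n) => i; rewrite geq_max => /andP[/um ui /vn vi].
  by rewrite -[LHS]/(u i - v i) ui vi subrr.
have [p [psurj p0]] := quot_proj (zmodClosed_of hS).
exists _, p; split=> // u; apply: iff_trans (p0 u) _.
by split=> [/zmodClosed_ofP|h] //; apply/zmodClosed_ofP.
Qed.

Lemma perp_torsion_free (G : zmodType) : perp ZomegaModSum G -> torsion_free G.
Proof.
move=> pG g n n_gt0 gn; apply: contrapT => g0.
pose I : set int := [set z | g *~ z = 0].
have hI : zmod_set I.
  by split=> [|z z' Iz Iz']; rewrite /I /= ?mulr0z // mulrzBr Iz Iz' subrr.
have [k k_gt0 [gk0 gk]] : exists2 k, (0 < k)%N & g *+ k = 0 /\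
    forall z, g *~ z = 0 -> exists q, z = q * k%:Z.
  have [d gd dP] := int_zmod_set hI; exists `|d|%N.
    rewrite absz_gt0; apply/eqP => d0; have [|q] := dP n%:Z; first exact: gn.
    by rewrite d0 mulr0 => /eqP; rewrite eqz_nat -leqn0 leqNgt n_gt0.
  case: d gd dP => m gm mP; first by split.
  split; first by apply/oppr_inj; rewrite oppr0.
  by move=> z /mP[q ->]; exists (- q); rewrite [in LHS]NegzE mulrN mulNr.
have k1 : (1 < k)%N.
  by case: k k_gt0 gk0 {gk} => [//|[|//]] _ g1; case: g0.
have [p [psurj p0]] := ZomegaModSum_proj.
have [D [pD [pDsurj pD0]]] := product_mod_sum rat.
have /choice[r rP] := psurj.
(* The inclusion of Z in Q, coordinatewise on chosen representatives; it is additive because these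
   are determined up to finitely many coordinates. *)
have [|j jE] := @additive_exists ZomegaModSum D (fun y => pD (fun i => (r y i)%:~R)).
  move=> x y; apply/eqP; rewrite -subr_eq0 -!raddfB; apply/eqP/pD0.
  have /p0[N hN] : p (r (x - y) - (r x - r y)) = 0 by rewrite !(raddfB p) !rP subrr.
  exists N => i /hN ri; rewrite -[LHS]/((r (x - y) i)%:~R - ((r x i)%:~R - (r y i)%:~R)).
  by rewrite -!intrB -[X in X%:~R]/((r (x - y) - (r x - r y)) i) ri.
have j_inj : injective j.
  move=> x y; rewrite !jE => /eqP; rewrite -subr_eq0 -raddfB => /eqP/pD0[N hN].
  apply/eqP; rewrite -subr_eq0 -[x]rP -[y]rP -raddfB; apply/eqP/p0; exists N => i /hN.
  rewrite -[LHS]/((r x i)%:~R - (r y i)%:~R) -intrB => /eqP.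
  by rewrite intr_eq0 => /eqP.
have divD : divisible D.
  move=> y m m_gt0; have [u <-] := pDsurj y.
  exists (pD (fun i => u i / m%:R)); rewrite -raddfMn; congr (pD _).
  apply/funext => i; rewrite pmulrn fct_mulz -pmulrn -[LHS]mulr_natr divfK //.
  by rewrite Num.Theory.pnatr_eq0 -lt0n.
have [E [e [eg ek]]] := torsion_extension (p (fun=> 1)) j_inj divD k_gt0 gk0 gk.
have [phi [_ phi_in _]] := pG E.
have [u uE] := psurj (phi e).1.
(* By the splitting, [k] times the first component of [phi e] is the class of the constant 1, so [k]
   divides 1 at some coordinate. *)
have /p0[N /(_ _ (leqnn N))] : p (u *+ k - (fun=> 1)) = 0.
  rewrite raddfB (raddfMn p) uE -(raddfMn fst) -(raddfMn phi) ek phi_in.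
  exact: subrr.
rewrite -[LHS]/((u *+ k) N - 1) pmulrn fct_mulz mulrzz => /eqP.
rewrite subr_eq0 => /eqP uk.
have : (k%:Z %| 1)%Z by apply/dvdzP; exists (u N).
by rewrite dvdzE /= dvdn1 => /eqP k1'; rewrite k1' in k1.
Qed.

(** * Galois types *)

Lemma pair_muln (U V : zmodType) (u : U) (v : V) n :
  (u, v) *+ n = (u *+ n, v *+ n).
Proof. by rewrite [LHS]surjective_pairing (raddfMn fst) (raddfMn snd). Qed.

Lemma perp_iff (G : zmodType) : perp ZomegaModSum G <-> torsion_free G.
Proof. by split; [apply: perp_torsion_free|apply: torsion_free_perp]. Qed.

(** * Strong submodels as pure subgroups *)

Definition pure (G H : zmodType) (f : G -> H) : Prop :=
  forall y n, (0 < n)%N -> (exists x, f x = y *+ n) -> exists x, f x = y.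

Lemma in_imP (U V : zmodType) (f : {additive U -> V}) y :
  y \in GRing.ZmodClosed.clone V (im f) _ <-> exists x, f x = y.
Proof.
by split=> [/set_mem[x _ <-]|[x <-]]; [exists x|apply/mem_set; exists x].
Qed.

(** The image is a copy of [G], and the quotient by it is torsion-free exactly when it is pure. *)
Lemma strong_embedding_iff (G H : zmodType) (f : {additive G -> H}) :
  strong_embedding ZomegaModSum f <-> [/\ injective f, torsion_free G & pure f].
Proof.
set I := GRing.ZmodClosed.clone H (im f) _.
have [p [psurj p0]] := quot_proj I.
have fI x : f x \in I by apply/in_imP; exists x.
split=> [[f_inj [/perp_iff tfI /perp_iff tfQ]]|[f_inj tfG f_pure]]; split=> //.
- move=> x n n_gt0 xn; apply: f_inj; rewrite raddf0.
  have := tfI (Subgroup (fI x)) n n_gt0 _.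
  move=> /(_ _)/(congr1 val) /= -> //; apply: val_inj.
  by rewrite raddfMn /= -raddfMn xn raddf0.
- move=> y n n_gt0 [x xy]; apply/in_imP/p0; apply: (tfQ _ n n_gt0).
  by rewrite -raddfMn; apply/p0; rewrite -xy.
- split; apply/perp_iff.
    move=> [y Iy] n n_gt0 /(congr1 val); rewrite raddfMn /= => yn; apply: val_inj.
    have /in_imP[x xy] := Iy; rewrite /= -xy (tfG x n) ?raddf0 //.
    by apply: f_inj; rewrite raddfMn raddf0 xy.
  move=> y n n_gt0; have [x <-] := psurj y; rewrite -raddfMn => /p0/in_imP xn.
  by apply/p0/in_imP; apply: (f_pure x n).
Qed.

(** * Galois types as divisibility patterns *)

Section Triples.
Context (M : zmodType).
Implicit Types t : triple ZomegaModSum M.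

(** The case n = 0 records the relations z a + m = 0. *)
Definition divides_in t (n : nat) (z : int) (m : M) : Prop :=
  exists y, y *+ n = tr_elt t *~ z + tr_incl t m.

(** A torsion element has the multiple 0 in the image of [M], hence lies in that image by purity. *)
Lemma triple_torsion_free t : torsion_free (tr_model t).
Proof.
have /strong_embedding_iff[i_inj tfM i_pure] := tr_strong t.
move=> y n n_gt0 yn; have [||x xy] := i_pure y n => //.
  by exists 0; rewrite raddf0 yn.
rewrite -xy (tfM x n) ?raddf0 //.
by apply: i_inj; rewrite raddfMn xy yn raddf0.
Qed.

Lemma directly_related_sym t t' : directly_related t t' -> directly_related t' t.
Proof. by move=> [N [f [g [? ? ? fgm fga]]]]; exists N, g, f; split. Qed.

(** A quotient by [n] found in one model is mapped to the amalgam, and purity of the other model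
    brings it back; for n = 0, injectivity suffices. *)
Lemma directly_related_divides t t' n z m :
  directly_related t t' -> divides_in t n z m -> divides_in t' n z m.
Proof.
move=> [N [f [g [_ _ /strong_embedding_iff[g_inj _ g_pure] fgm fga]]]] [y yE].
have fyE : g (tr_elt t' *~ z + tr_incl t' m) = f y *+ n.
  by rewrite raddfD raddfMz -fgm -fga -raddfMz -raddfD -yE raddfMn.
have [n0|n_gt0] := posnP n.
  exists 0; apply: g_inj; by rewrite fyE n0 !mulr0n raddf0.
have [||y' y'E] := g_pure (f y) n => //; first by eexists; exact: fyE.
by exists y'; apply: g_inj; rewrite fyE raddfMn y'E.
Qed.

(** The pure closure of the subgroup of all (z a + m, - (z a' + m)), which an amalgam has to kill.
    Purity keeps the quotient torsion-free. *)
Definition glue t t' : set (tr_model t * tr_model t') :=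
  [set p | exists n z m, [/\ (0 < n)%N, p.1 *+ n = tr_elt t *~ z + tr_incl t m
    & p.2 *+ n = - (tr_elt t' *~ z + tr_incl t' m)]].

Lemma glue_sym t t' x x' : glue (x, x') -> @glue t' t (x', x).
Proof.
move=> [n [z [m [n_gt0 /= xE x'E]]]]; exists n, (- z), (- m); split=> //=.
  by rewrite x'E raddfN; zmod.
by rewrite xE raddfN; zmod.
Qed.

Lemma glue_zmod t t' : zmod_set (@glue t t').
Proof.
split=> [|[x x'] [y y'] [n [z [m [/= n_gt0 xE x'E]]]] [l [w [k [/= l_gt0 yE y'E]]]]].
  exists 1%N, 0, 0; rewrite /= !raddf0; split=> //; zmod.
exists (n * l)%N, (z * l%:Z - w * n%:Z), (m *+ l - k *+ n); split=> /=.
- by rewrite muln_gt0 n_gt0.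
- transitivity ((x *+ n) *+ l - (y *+ l) *+ n); first by zmod.
  by rewrite xE yE (raddfB (tr_incl t)) !(raddfMn (tr_incl t)); zmod.
- transitivity ((x' *+ n) *+ l - (y' *+ l) *+ n); first by zmod.
  by rewrite x'E y'E (raddfB (tr_incl t')) !(raddfMn (tr_incl t')); zmod.
Qed.

Section Amalgam.
Context (t t' : triple ZomegaModSum M).
Hypothesis tt' : forall n z m, divides_in t' n z m -> divides_in t n z m.

(** Here z a' + m = 0, and the divisor 0 carries this relation over to z a + m. *)
Lemma glue_inj x : @glue t t' (x, 0) -> x = 0.
Proof.
move=> [n [z [m [/= n_gt0 xE /esym/eqP]]]].
rewrite mul0rn oppr_eq0 => /eqP e.
have [y /esym] : divides_in t 0%N z m by apply: tt'; exists 0; rewrite e.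
rewrite mulr0n => e'.
by apply: (triple_torsion_free n_gt0); rewrite xE.
Qed.

(** In the second model [y'] witnesses that n l divides z a' + m. A quotient [w] in the first model,
    transferred by [tt'], replaces it. *)
Lemma glue_pure x y y' n : (0 < n)%N -> @glue t t' (x - y *+ n, - y' *+ n) ->
  exists x0, @glue t t' (x0 - y, - y').
Proof.
move=> n_gt0 [l [z [m [/= l_gt0 xE y'E]]]].
have [w wE] : divides_in t (n * l)%N z m.
  by apply: tt'; exists y'; apply: oppr_inj; rewrite -y'E; zmod.
exists (w + y), (n * l)%N, z, m; split=> /=.
- by rewrite muln_gt0 n_gt0.
- by rewrite addrK.
- by rewrite -y'E; zmod.
Qed.

End Amalgam.

(** The amalgam is the product modulo [glue]. [glue_inj] and [glue_pure] make the first model strong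
    in it, and [glue_sym] exchanges the two models. *)
Lemma divides_directly_related t t' :
  (forall n z m, divides_in t n z m <-> divides_in t' n z m) ->
  directly_related t t'.
Proof.
move=> tt'.
have [q [qsurj q0]] := quot_proj (zmodClosed_of (glue_zmod t t')).
have qE p p' : q p = q p' <-> glue (p - p').
  have -> : glue (p - p') <-> q (p - p') = 0.
    by split=> [h|/q0/zmodClosed_ofP//]; apply/q0/zmodClosed_ofP.
  rewrite raddfB; split=> [->|/eqP]; first exact: subrr.
  by rewrite subr_eq0 => /eqP.
have [|f fE] := @additive_exists (tr_model t) _ (fun x => q (x, 0)).
  by move=> x y; rewrite -raddfB; congr (q _); congr pair; rewrite subrr.
have [|g gE] := @additive_exists (tr_model t') _ (fun x => q (0, x)).
  by move=> x y; rewrite -raddfB; congr (q _); congr pair; rewrite subrr.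
exists _, f, g; split.
- apply/perp_iff => y n n_gt0; have [p <-] := qsurj y.
  rewrite -raddfMn -{1}(raddf0 q) => /qE; rewrite subr0.
  move=> [l [z [m [l_gt0 /= p1 p2]]]]; rewrite -(raddf0 q); apply/qE; rewrite subr0.
  exists (n * l)%N, z, m; split; rewrite ?muln_gt0 ?n_gt0 //.
    by rewrite -p1 (raddfMn fst); zmod.
  by rewrite -p2 (raddfMn snd); zmod.
- apply/strong_embedding_iff; split; last 1 first.
  + move=> y n n_gt0 [x]; have [[u v] <-] := qsurj y.
    rewrite fE -raddfMn => /qE.
    have -> : (x, 0) - (u, v) *+ n = (x - u *+ n, - v *+ n).
      by rewrite pair_muln !mulNrn; congr pair; rewrite sub0r.
    move=> /glue_pure[|//|x0 gx0]; first by move=> *; apply/tt'.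
    exists x0; rewrite fE; apply/qE.
    by have -> : (x0, 0) - (u, v) = (x0 - u, - v) by congr pair; rewrite sub0r.
  + move=> x y; rewrite !fE => /qE.
    have -> : (x, 0) - (y, 0) = (x - y, 0) :> tr_model t * tr_model t'.
      by congr pair; rewrite subr0.
    move=> /glue_inj h; apply/eqP; rewrite -subr_eq0; apply/eqP/h => *.
    exact/tt'.
  + exact: triple_torsion_free.
- apply/strong_embedding_iff; split; last 1 first.
  + move=> y n n_gt0 [x]; have [[u v] <-] := qsurj y.
    rewrite gE -raddfMn => /qE.
    have -> : (0, x) - (u, v) *+ n = (- u *+ n, x - v *+ n).
      by rewrite pair_muln !mulNrn; congr pair; rewrite sub0r.
    move=> /glue_sym/glue_pure[|//|x0 /glue_sym gx0]; first by move=> *; apply/tt'.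
    exists x0; rewrite gE; apply/qE.
    by have -> : (0, x0) - (u, v) = (- u, x0 - v) by congr pair; rewrite sub0r.
  + move=> x y; rewrite !gE => /qE.
    have -> : (0, x) - (0, y) = (0, x - y) :> tr_model t * tr_model t'.
      by congr pair; rewrite subr0.
    move=> /glue_sym/glue_inj h; apply/eqP; rewrite -subr_eq0; apply/eqP/h => *.
    exact/tt'.
  + exact: triple_torsion_free.
- move=> m; rewrite fE gE; apply/qE; exists 1%N, 0, m; split=> //=; zmod.
- rewrite fE gE; apply/qE; exists 1%N, 1, 0; rewrite !raddf0; split=> //=; zmod.
Qed.

Lemma same_galois_type_iff t t' : same_galois_type t t' <->
  forall n z m, divides_in t n z m <-> divides_in t' n z m.
Proof.
split=> [|tt']; last exact/rst_step/divides_directly_related.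
elim=> {t t'} [t t' tt' n z m|//|t t' _ IH n z m|t1 t2 t3 _ IH1 _ IH2 n z m].
- split; apply: directly_related_divides => //.
  exact: directly_related_sym.
- by split=> /IH.
- by split=> [/IH1/IH2|/IH2/IH1].
Qed.

(** [divides_in t n z] is empty or a coset of [nM]. *)
Definition type_code t (nz : nat * int) : option M :=
  let S := divides_in t nz.1 nz.2 in
  if pselect (exists m, S m) then Some (xget 0 S) else None.

(** For n > 0, purity of [M] in the first model writes the difference of two members of the coset as
    n u with [u] in [M]; the same [u] corrects the quotient in the second model. *)
Lemma type_code_divides t t' n z m : type_code t = type_code t' ->
  divides_in t n z m -> divides_in t' n z m.
Proof.
move=> /(congr1 (fun c => c (n, z))); rewrite /type_code /=.
case: pselect => [[m1 m1S]|nS _ mS]; last by case: nS; exists m.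
case: pselect => [[m2 m2S] [mE] [y yE]|//].
have [y0 y0E] : divides_in t n z (xget 0 (divides_in t n z)) by apply: xgetI m1S.
have [y1 y1E] : divides_in t' n z (xget 0 (divides_in t n z)).
  by rewrite mE; apply: xgetI m2S.
move: (xget _ _) y0E y1E => m0 y0E y1E.
have /strong_embedding_iff[i_inj _ i_pure] := tr_strong t.
have yy0 : tr_incl t (m - m0) = (y - y0) *+ n.
  by rewrite mulrnBl yE y0E raddfB; zmod.
have [n0|n_gt0] := posnP n.
  have -> : m = m0.
    apply/eqP; rewrite -subr_eq0; apply/eqP/i_inj.
    by rewrite yy0 n0 mulr0n raddf0.
  by exists y1.
have [||u uE] := i_pure (y - y0) n => //; first by exists (m - m0).
exists (y1 + tr_incl t' u).
have -> : m = m0 + u *+ n.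
  apply: i_inj; rewrite raddfD raddfMn uE -yy0 raddfB; zmod.
by rewrite mulrnDl y1E raddfD raddfMn; zmod.
Qed.

Lemma type_code_iff t t' : type_code t = type_code t' <-> same_galois_type t t'.
Proof.
split=> [tt'|/same_galois_type_iff tt'].
  apply/same_galois_type_iff => n z m.
  by split; apply: type_code_divides.
apply/funext => -[n z]; rewrite /type_code /=.
suff -> : divides_in t n z = divides_in t' n z by [].
by apply/funext => m; apply/propext.
Qed.

End Triples.

(** * Countable powers bound the number of types *)

Lemma stable_of_pow L : embeds nat L -> embeds (nat -> L) L ->
  stable_in ZomegaModSum L.
Proof.
move=> infL powL M _ /card_eq_embeds[ML _].
have sqL := embeds_square infL; have [e _] := infL.
have [f f_inj] : embeds (nat * int -> option M) L.
  apply: embeds_trans powL; apply: embeds_fun.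
  - by exists pickle; apply: pcan_inj pickleK.
  - apply: (@embeds_trans (bool * L)%type).
      have [h h_inj] := ML.
      exists (fun o => if o is Some m then (true, h m) else (false, e 0%N)).
      by move=> [m|] [m'|] //= [/h_inj->].
    apply: embeds_prod_self => //; last exact: embeds_refl.
    exact: embeds_count.
  - exact: (inhabits None).
exists (fun t => f (type_code t)) => t t'; rewrite -type_code_iff.
by split=> [/f_inj|->].
Qed.

(** * Many types over a free group *)

Section Unstable.
Context (C : choiceType).
Hypothesis infC : embeds nat C.

Local Notation X := (nat * C)%type.

(** The free group on [nat * C], inside the product that serves as the larger model. *)
Definition finsupp_fun : set (X -> int) :=
  [set u | exists s : seq X, forall x, x \notin s -> u x = 0].

Lemma finsupp_fun_zmod : zmod_set finsupp_fun.
Proof.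
split=> [|u v [s us] [r vr]]; first by exists [::].
exists (s ++ r) => x; rewrite mem_cat negb_or => /andP[/us ux /vr vx].
by rewrite -[LHS]/(u x - v x) ux vx subrr.
Qed.

Let M : zmodType := subgroup (zmodClosed_of finsupp_fun_zmod).

Let M_mem (u : X -> int) : finsupp_fun u -> u \in zmodClosed_of finsupp_fun_zmod.
Proof. by move=> h; apply: (introT (zmodClosed_ofP _ _)). Qed.

Let M_supp (m : M) : finsupp_fun (val m).
Proof. case: m => u hu; exact: (elimT (zmodClosed_ofP _ _) hu). Qed.

Lemma torsion_free_fun : torsion_free (X -> int).
Proof.
move=> u n n_gt0 un; apply/funext => x; apply/eqP.
have := congr1 (fun v => v x) un; rewrite pmulrn fct_mulz => /eqP.
by rewrite mulrzz mulf_eq0 => /orP[//|]; rewrite eqz_nat -leqn0 leqNgt n_gt0.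
Qed.

Lemma torsion_free_M : torsion_free M.
Proof.
move=> m n n_gt0 mn; apply: val_inj; apply: (torsion_free_fun n_gt0).
by rewrite -raddfMn mn raddf0.
Qed.

(** A function is recovered from its list of argument-value pairs on a finite support; conversely
    [C] embeds through the basis vectors at [(0, c)]. *)
Lemma card_M : ([set: M] #= [set: C])%card.
Proof.
have sqC := embeds_square infC.
rewrite card_eq_le; apply/andP; split; apply/card_le_embeds.
  have XZ : embeds (X * int) C.
    by do !apply: embeds_prod_self => //; [exact: embeds_refl|exact: embeds_count].
  have [c0 _] := infC.
  have infXZ : embeds nat (X * int).
    by exists (fun n => ((n, c0 0%N), 0)) => m n [].
  apply: embeds_trans XZ; apply: embeds_trans (embeds_seq infXZ (embeds_square infXZ)).
  have /choice[s sP] := M_supp.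
  exists (fun m => [seq (x, val m x) | x <- s m]) => m m' e.
  apply/val_inj/funext => x.
  have [xs|xs] := boolP (x \in s m).
    have : (x, val m x) \in [seq (x, val m' x) | x <- s m'] by rewrite -e; apply: map_f.
    by move=> /mapP[y _ [<- vE]]; exact: vE.
  have [xs'|xs'] := boolP (x \in s m').
    have : (x, val m' x) \in [seq (x, val m x) | x <- s m] by rewrite e; apply: map_f.
    by move=> /mapP[y ys [xy _]]; rewrite xy ys in xs.
  by rewrite !sP.
have dP c : finsupp_fun (fun x : X => (x == (0%N, c))%:Z).
  by exists [:: (0%N, c)] => x; rewrite inE => /negPf->.
exists (fun c => Subgroup (M_mem (dP c))) => c c' /(congr1 val) /=.
by move=> /(congr1 (fun u => u (0%N, c))); rewrite eqxx; case: eqP => // -[].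
Qed.

Lemma val_M_strong (i : {additive M -> (X -> int)}) :
  i =1 val -> strong_embedding ZomegaModSum i.
Proof.
move=> iE; apply/strong_embedding_iff; split.
- by move=> m m'; rewrite !iE => /val_inj.
- exact: torsion_free_M.
- move=> y n n_gt0 [m mE]; have [s sP] := M_supp m.
  have hy : finsupp_fun y.
    exists s => x /sP; rewrite -iE mE pmulrn fct_mulz mulrzz => /eqP.
    by rewrite mulf_eq0 => /orP[/eqP//|]; rewrite eqz_nat -leqn0 leqNgt n_gt0.
  by exists (Subgroup (M_mem hy)); rewrite iE.
Qed.

(** The branch [eta] is coded by the 2-adic limit of the finite sums of
    [2 ^ k] times the basis vector at [(k, eta k)]. *)
Definition branch (eta : nat -> C) : X -> int :=
  fun x => if eta x.1 == x.2 then (2 ^ x.1)%N%:Z else 0.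

Lemma pow_of_stable : stable_in ZomegaModSum C -> embeds (nat -> C) C.
Proof.
move=> stC; have [//|i iE] := @additive_exists M (X -> int) val.
have [c cP] := stC M (torsion_free_perp torsion_free_M) card_M.
pose t eta := Triple (val_M_strong iE) (branch eta).
exists (fun eta => c (t eta)) => eta eta' /cP/same_galois_type_iff tt'.
apply/funext => k; apply: contrapT => /eqP ne.
(* Adding [u] removes the terms of index at most [k] from [branch eta], and 2^(k+1) divides what
   remains. *)
pose u (x : X) : int := if (x.1 <= k)%N then - branch eta x else 0.
have hu : finsupp_fun u.
  exists [seq (l, eta l) | l <- iota 0 k.+1] => x; apply: contraNeq.
  rewrite /u /branch; case: leqP => [xk|_]; last by rewrite eqxx.
  case: (eta x.1 =P x.2) => [ex _|_]; last by rewrite oppr0 eqxx.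
  by apply/mapP; exists x.1; rewrite ?mem_iota // ex -surjective_pairing.
have [y] : divides_in (t eta') (2 ^ k.+1)%N 1 (Subgroup (M_mem hu)).
  apply/tt'; exists (fun x => if (k < x.1)%N && (eta x.1 == x.2)
    then (2 ^ (x.1 - k.+1))%N%:Z else 0).
  rewrite /= iE /=; apply/funext => -[l d]; rewrite pmulrn fct_mulz mulrzz.
  rewrite -[RHS]/((branch eta *~ 1) (l, d) + u (l, d)) mulr1z /u /branch /=.
  case: leqP => lk /=; first by rewrite mul0r subrr.
  case: eqP => _; last by rewrite mul0r addr0.
  by rewrite -PoszM -expnD subnK // addr0.
(* At this coordinate [branch eta'] vanishes and [u] is -2^k, which is no multiple of 2^(k+1). *)
move=> /(congr1 (fun v => v (k, eta k))).
rewrite /= iE /= pmulrn fct_mulz mulrzz.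
rewrite -[RHS]/((branch eta' *~ 1) (k, eta k) + u (k, eta k)) mulr1z /u /branch /=.
rewrite leqnn eqxx eq_sym (negPf ne) add0r expnS; move: (y _) => z.
have : (0 < 2 ^ k)%N by rewrite expn_gt0.
move: (2 ^ k)%N => p p_gt0; rewrite PoszM => zE.
have : (z * 2%:Z + 1) * p%:Z == 0.
  have -> : (z * 2%:Z + 1) * p%:Z = z * (2%:Z * p%:Z) + p%:Z by ring.
  by rewrite zE addNr.
by rewrite mulf_eq0 => /orP[] /eqP; lia.
Qed.

End Unstable.

(** [{classic L}] supplies the choice structure on which the finite supports rely. *)
Lemma pow_of_stable_infinite (L : Type) :
  embeds nat L -> stable_in ZomegaModSum L -> embeds (nat -> L) L.
Proof. exact: (@pow_of_stable {classic L}). Qed.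

Local Close Scope quotient_scope.
Local Close Scope ring_scope.
Local Close Scope classical_set_scope.

Theorem corollary3p2 :
  (CH ->
     (forall (n : nat) (L : Type),
        0 < n -> is_aleph n L -> stable_in ZomegaModSum L) /\
     (forall L : Type, is_aleph_omega L -> ~ stable_in ZomegaModSum L)) /\
  (~ CH -> forall L : Type, is_aleph 1 L -> ~ stable_in ZomegaModSum L).
Proof.
split=> [ch|nch L L1 stL]; first split=> [n L n_gt0 Ln|L Lw stL].
- by apply: stable_of_pow; [exact: is_aleph_infinite Ln|exact: CH_aleph_pow Ln].
- have infL := aleph_omega_infinite Lw.
  exact: aleph_omega_pow Lw (pow_of_stable_infinite infL stL).
- apply/nch/(aleph1_pow_CH L1)/pow_of_stable_infinite => //.
  exact: (is_aleph_infinite (L1 : is_aleph 1 L)).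
Qed.
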